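(* For every $\gamma\in[1/2,1]$, $$\dim\bigl\{\alpha\in(0,1):\ \overline{\Gamma}(\alpha,\beta)=\gamma\ \text{ for almost every } \beta\in(0,1)\bigr\} = 2-2\gamma,$$ where $\dim$ denotes Hausdorff dimension and $\alpha$ ranges over irrational numbers.
   Context: Edit distance: for finite words $w,\tilde w$ over an alphabet, $\mathrm{d}_E(w,\tilde w)$ is half the minimal number of operations needed to transform $w$ into $\tilde w$, where an operation is the deletion or the insertion of a single letter at an arbitrary position. Coding: $\mathbb{T}=\mathbb{R}/\mathbb{Z}$ is identified with $[0,1)$; $x \bmod 1$ is the unique element of $x+\mathbb{Z}$ in $[0,1)$. For $\alpha\in\mathbb{R}\setminus\mathbb{Q}$, $\beta\in(0,1)$, $x\in\mathbb{T}$, $n\in\mathbb{Z}$, let $\xi_n(x):=\mathbf{1}_{[0,\beta)}(x+n\alpha \bmod 1)$, and $\xi_{[0,N)}(x):=(\xi_n(x))_{n=0}^{N-1}\in\{0,1\}^N$. Put $\mathcal{W}_N:=\{\xi_{[0,N)}(x):x\in\mathbb{T}\}$, $\mathrm{diam}_E(\mathcal{W}_N):=\max\{\mathrm{d}_E(w,\tilde w):w,\tilde w\in\mathcal{W}_N\}$, and $\overline{\Gamma}(\alpha,\beta):=\limsup_{N\to\infty}\frac{\log \mathrm{diam}_E(\mathcal{W}_N)}{\log N}$. ''Almost every'' refers to Lebesgue measure. *)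

(* Defs.v *)
From HB Require Import structures.
From mathcomp Require Import all_boot all_order all_algebra.
From mathcomp Require Import all_classical all_reals all_analysis.

Set Implicit Arguments.
Unset Strict Implicit.
Unset Printing Implicit Defensive.

Import Order.TTheory GRing.Theory Num.Theory.

Local Open Scope classical_set_scope.
Local Open Scope ring_scope.

Section edit_distance.
Variable T : Type.
Implicit Types u v w : seq T.

Inductive edit_op : seq T -> seq T -> Prop :=
| Edit_delete u a v : edit_op (u ++ a :: v) (u ++ v)
| Edit_insert u a v : edit_op (u ++ v) (u ++ a :: v).

Fixpoint edit_ops (n : nat) w w' : Prop :=
  if n is n'.+1 then exists2 v, edit_op w v & edit_ops n' v w' else w = w'.

Lemma edit_ops_exists w w' : exists n, `[< edit_ops n w w' >].
Proof.
suff [n nP] : exists n, edit_ops n w w' by exists n; apply/asboolP.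
elim: w => [|a w [n IHw]].
  elim/last_ind: w' => [|w' a [n IHw']]; first by exists 0%N.
  exists n.+1; elim: n [::] IHw' => [|n IHn] v /=.
    move=> ->; exists (rcons w' a) => //.
    by rewrite -cats1 -[X in edit_op X]cats0; constructor.
  by case=> x vx /IHn h; exists x.
by exists n.+1; exists w => //; apply: (@Edit_delete [::]).
Qed.

Definition edit_count w w' : nat := ex_minn (edit_ops_exists w w').

Definition edit_dist (R : realType) w w' : R := (edit_count w w')%:R / 2.

End edit_distance.

Section rotation_coding.
Variable R : realType.
Implicit Types a b x : R.

Definition mod1 x : R := x - (Num.floor x)%:~R.

(* The letters 1 and 0 are encoded as true and false. *)
Definition coding a b (n : int) x : bool := mod1 (x + n%:~R * a) \in `[0, b[.

Definition coding_word a b (N : nat) x : N.-tuple bool :=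
  [tuple coding a b (i : nat)%:Z x | i < N].

(* The circle R/Z is represented by its fundamental domain [0, 1). *)
Definition coding_words a b (N : nat) : set (N.-tuple bool) :=
  [set coding_word a b N x | x in `[0, 1[].

(* The distances are nonnegative, so the default value 0 is harmless: this is
   the maximum over the finite nonempty set of pairs of words. *)
Definition diam_edit a b (N : nat) : R :=
  \big[Num.max/0]_(p : N.-tuple bool * N.-tuple bool |
      (p.1 \in @coding_words a b N) && (p.2 \in @coding_words a b N))
    edit_dist R p.1 p.2.

(* The quotient is meaningless for N <= 1, which does not affect the limsup. *)
Definition upper_Gamma a b : \bar R :=
  limn_esup (fun N : nat => (ln (diam_edit a b N) / ln N%:R)%:E).

End rotation_coding.

Section hausdorff_dimension.
Variable R : realType.
Local Open Scope ereal_scope.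
Implicit Types (E U : set R) (s delta : R).

(* This is -oo on the empty set. *)
Definition ediam U : \bar R := ereal_sup [set `|p.1 - p.2|%:E | p in U `*` U].

(* diam(U)^s, where the empty set counts for 0 also when s = 0. *)
Definition ediam_pow s U : \bar R :=
  if U == set0 then 0 else poweR (ediam U) s.

Definition hausdorff_content s delta E : \bar R :=
  ereal_inf [set \sum_(k <oo) ediam_pow s (U k) | U in
    [set U : (set R)^nat |
      E `<=` \bigcup_k U k /\ forall k, ediam (U k) <= delta%:E]].

Definition hausdorff_measure s E : \bar R :=
  ereal_sup [set hausdorff_content s delta E | delta in `]0%R, +oo[].

Definition hausdorff_dim E : \bar R :=
  ereal_inf [set s%:E | s in [set s | (0 <= s)%R /\ hausdorff_measure s E = 0]].

End hausdorff_dimension.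

(* Main.v *)
Require Import Defs.
From mathcomp Require Import all_boot all_order all_algebra.
From mathcomp Require Import zify ring lra.
From mathcomp Require Import all_classical all_reals all_analysis.

(** Write tau for the exponent with |q a - p| about q^-tau along the best
    approximations p/q of a.  The edit diameter grows like N^(tau / (tau + 1)),
    and by Jarnik and Besicovitch such numbers a form a set of dimension
    2 / (tau + 1).  No continued fractions are needed.

    Upper bound on the diameter: if p/q is reduced and |q a - p| <= 1/q, some
    shift by s < q places brings the orbit of x within 2/q of that of y; the
    remaining mismatches occur only when the orbit is within 2/q of 0 or b, so
    the diameter is O(q + N/q), and Dirichlet's theorem provides a suitable q.

    Lower bound on the diameter: let eps = q a - p > 0 be tiny.  Modulo 1/q the
    rotation is a slow drift by eps/q per step.  Start two orbits 1/(2q) apart.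
    Shifting by less than a constant times 1/eps places leaves them about half
    of 1/q apart modulo 1/q, so a block of q letters cannot be matched when the
    phase of the orbit makes it cross 0 or b; if q b is not close to an
    integer, this happens for a positive proportion of the phases, whatever the
    sign of the shift.  Hence about 1/eps operations are needed for words of
    length q/eps.  For almost every b the distance from q b to the integers is
    bounded below along infinitely many of the good q.

    Dimension: the upper bound is the usual cover of a limsup set.  For the
    lower bound we construct a Cantor set of numbers that are badly approximable
    except at sparse scales, where each interval is replaced by a tiny one next
    to a fraction it contains.  Its points are parametrized by [0, 1) through
    base m digits; the inverse of the parametrization is s-Hoelder, so that the
    s-dimensional measure is bounded below by the Lebesgue measure of [0, 1). *)

Set Implicit Arguments.
Unset Strict Implicit.
Unset Printing Implicit Defensive.

(** * Edit operations *)

Section edit_operations.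
Variable T : Type.
Implicit Types (u v w x y : seq T) (n : nat).

Lemma edit_countP u v : edit_ops (edit_count u v) u v.
Proof. by rewrite /edit_count; case: ex_minnP => n /boolp.asboolP. Qed.

Lemma edit_count_le n u v : edit_ops n u v -> edit_count u v <= n.
Proof.
move=> uv; rewrite /edit_count; case: ex_minnP => m _; apply.
exact/boolp.asboolP.
Qed.

Lemma edit_ops_trans m n u v w :
  edit_ops m u v -> edit_ops n v w -> edit_ops (m + n) u w.
Proof.
elim: m u => [|m IHm] u /=; first by move=> ->.
by case=> z uz zv vw; exists z => //; apply: IHm vw.
Qed.

Lemma edit_op_cat x y u v : edit_op u v -> edit_op (x ++ u ++ y) (x ++ v ++ y).
Proof.
case=> [u1 a v1|u1 a v1]; rewrite -!catA !cat_cons !(catA x u1).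
- exact: Edit_delete.
- exact: Edit_insert.
Qed.

Lemma edit_ops_cat n x y u v :
  edit_ops n u v -> edit_ops n (x ++ u ++ y) (x ++ v ++ y).
Proof.
elim: n u => [|n IHn] u /=; first by move=> ->.
by case=> z uz zv; exists (x ++ z ++ y); [exact: edit_op_cat|exact: IHn].
Qed.

Lemma edit_ops_drop x u : edit_ops (size x) (x ++ u) u.
Proof.
elim: x => //= a x IHx; exists (x ++ u) => //.
exact: (@Edit_delete _ [::] a (x ++ u)).
Qed.

Lemma edit_ops_append u y : edit_ops (size y) u (u ++ y).
Proof.
elim: y u => [|a y IHy] u /=; first by rewrite cats0.
exists (u ++ [:: a]); last by have := IHy (u ++ [:: a]); rewrite -catA.
by rewrite -{1}[u]cats0; exact: Edit_insert.
Qed.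

End edit_operations.

(** A mismatch is repaired by one deletion and one insertion, hence the factor 2. *)
Lemma edit_ops_mkseq (T : eqType) (f h : nat -> T) N :
  edit_ops (2 * count (fun i => f i != h i) (iota 0 N)) (mkseq f N) (mkseq h N).
Proof.
elim: N => [//|N IHN]; rewrite !mkseqS -!cats1 -[in iota _ N.+1]addn1 iotaD.
rewrite count_cat /= addn0 mulnDr add0n.
apply: (@edit_ops_trans _ _ _ _ (mkseq h N ++ [:: f N])).
  exact: (@edit_ops_cat _ _ [::]).
have [->|_] := eqVneq; first by rewrite muln0.
exists (mkseq h N).
  by rewrite -[X in edit_op _ X]cats0; exact: Edit_delete.
exists (mkseq h N ++ [:: h N]) => //.
by rewrite -[X in edit_op X]cats0; exact: Edit_insert.
Qed.

(** Delete the first [s] letters of one word, repair the mismatches on the overlap, append the last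
    [s] letters of the other. *)
Lemma edit_count_shift (T : eqType) (f h : nat -> T) N s : s <= N ->
  edit_count (mkseq f N) (mkseq h N) <=
    2 * s + 2 * count (fun i => f (s + i) != h i) (iota 0 (N - s)).
Proof.
move=> sN; have sE (k : nat -> T) a b :
    mkseq k (a + b) = mkseq k a ++ mkseq (fun i => k (a + i)) b.
  by rewrite /mkseq iotaD map_cat add0n -[a in iota a b]addn0 iotaDl -map_comp.
have -> : mkseq f N = mkseq f s ++ mkseq (fun i => f (s + i)) (N - s).
  by rewrite -sE subnKC.
have -> : mkseq h N = mkseq h (N - s) ++ mkseq (fun i => h (N - s + i)) s.
  by rewrite -sE subnK.
apply: edit_count_le; rewrite mul2n -addnn -addnA (addnC s (2 * _)).
apply: (@edit_ops_trans _ _ _ _ (mkseq (fun i => f (s + i)) (N - s))).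
  by rewrite -{1}(size_mkseq f s); exact: edit_ops_drop.
apply: (@edit_ops_trans _ _ _ _ (mkseq h (N - s))).
  exact: (@edit_ops_mkseq _ (fun i => f (s + i))).
rewrite -{1}(size_mkseq (fun i => h (N - s + i)) s); exact: edit_ops_append.
Qed.

(** * Factors that survive few operations *)

Section surviving_factors.
Variables (T : Type) (x0 : T) (L : nat).
Implicit Types (u v w : seq T) (c : seq nat).

Let apart := pairwise (fun i j => i + L <= j).

Lemma apart_count d c : apart c -> count (fun i => i <= d < i + L) c <= 1.
Proof.
elim: c => //= i c IHc /andP[/allP ic /IHc].
case: (boolP (i <= d < i + L)) => [id _|_ //].
suff -> : count (fun i => i <= d < i + L) c = 0 by [].
by apply/eqP; rewrite -leqn0 leqNgt -has_count; apply/hasPn => j /ic; lia.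
Qed.

(** Treats deletion and insertion at once: [p] selects the factors left intact by an operation at
    [d], and [f] moves them. The others contain [d], so there is at most one. *)
Lemma apart_image (p : pred nat) (f : nat -> nat) d c : apart c ->
    (forall i j, p i -> p j -> i + L <= j -> f i + L <= f j) ->
    (forall i, ~~ p i -> i <= d < i + L) ->
  let c' := map f (seq.filter p c) in apart c' /\ size c <= (size c').+1.
Proof.
move=> ac fp pd /=; split; last first.
  rewrite size_map size_filter -(count_predC p c) -addn1 leq_add2l.
  by apply: leq_trans (apart_count d ac); apply: sub_count => i /pd.
move: ac; rewrite /apart pairwise_map.
elim: c => //= i c IHc /andP[/allP ic /IHc ac].
case: ifP => //= pi; rewrite ac andbT; apply/allP => j.
by rewrite mem_filter => /andP[pj /ic]; exact: fp.
Qed.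

(* An operation destroys at most one of the disjoint factors marked by [c] and
   shifts each of the others by at most one place. *)
Lemma edit_op_survive w v c : edit_op w v -> apart c ->
    all (fun i => i + L <= size w) c ->
  exists c', [/\ apart c', all (fun i => i + L <= size v) c',
    size c <= (size c').+1 & forall i', i' \in c' ->
      exists2 i, i \in c & [/\ i <= i'.+1, i' <= i.+1 &
        forall r, r < L -> nth x0 v (i' + r) = nth x0 w (i + r)]].
Proof.
case=> u a z ac /allP sc.
- have [] := @apart_image (fun i => (size u < i) || (i + L <= size u))
    (fun i => if size u < i then i.-1 else i) (size u) c ac.
  + by move=> i j; case: ifP; case: ifP; lia.
  + by move=> i; lia.
  set c' := map _ _ => ac' sc'; exists c'; split => //.
    apply/allP => _ /mapP[i + ->]; rewrite mem_filter => /andP[pi /sc].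
    by rewrite !size_cat /=; move: pi; case: ifP; lia.
  move=> _ /mapP[i + ->]; rewrite mem_filter => /andP[pi ic]; exists i => //.
  split; [by case: ifP; lia|by case: ifP; lia|move=> r rL; rewrite !nth_cat].
  move: pi; have [ui _|_ /= iu] := ltnP (size u) i.
  + have -> : i.-1 + r < size u = false by lia.
    have -> : i + r < size u = false by lia.
    by have -> : i + r - size u = (i.-1 + r - size u).+1 by lia.
  + by have -> : i + r < size u by lia.
(* An insertion just before a factor leaves it intact, so here the factor starting at [size u] is
   kept as well. *)
- have [] := @apart_image (fun i => (size u <= i) || (i + L <= size u))
    (fun i => if size u <= i then i.+1 else i) (size u) c ac.
  + by move=> i j; case: ifP; case: ifP; lia.
  + by move=> i; lia.
  set c' := map _ _ => ac' sc'; exists c'; split => //.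
    apply/allP => _ /mapP[i + ->]; rewrite mem_filter => /andP[pi /sc].
    by rewrite !size_cat /=; move: pi; case: ifP; lia.
  move=> _ /mapP[i + ->]; rewrite mem_filter => /andP[pi ic]; exists i => //.
  split; [by case: ifP; lia|by case: ifP; lia|move=> r rL; rewrite !nth_cat].
  move: pi; have [ui _|_ /= iu] := leqP (size u) i.
  + have -> : i.+1 + r < size u = false by lia.
    have -> : i + r < size u = false by lia.
    by have -> : i.+1 + r - size u = (i + r - size u).+1 by lia.
  + by have -> : i + r < size u by lia.
Qed.

(** Each operation loses at most one factor and moves the others by at most one place, so one factor
    is left after [n] operations. *)
Lemma edit_ops_survive n w v c : edit_ops n w v -> apart c ->
    all (fun i => i + L <= size w) c -> n < size c ->
  exists2 i, i \in c & exists j, [/\ i <= j + n, j <= i + n, j + L <= size v &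
    forall r, r < L -> nth x0 v (j + r) = nth x0 w (i + r)].
Proof.
elim: n w c => [|n IHn] w c /=.
  case: c => // i c -> _ /andP[iw _] _; exists i; first exact: mem_head.
  by exists i; rewrite addn0; split.
case=> z wz zv ac sc nc.
have [c' [ac' sc' cc' c'c]] := edit_op_survive wz ac sc.
have [|i' i'c' [j [ij ji jv jw]]] := IHn z c' zv ac' sc'; first by lia.
have [i ic [ii' i'i iw]] := c'c i' i'c'.
exists i => //; exists j; split; [lia|lia|done|].
by move=> r rL; rewrite jw// iw.
Qed.

End surviving_factors.

Import Order.TTheory GRing.Theory Num.Theory.

Local Open Scope ring_scope.

(** * Words of a rotation close to a rational one *)

Lemma floor_bounds (R : realType) (x : R) :
  (Num.floor x)%:~R <= x < (Num.floor x)%:~R + 1.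
Proof. by have := real_floor_itv (num_real x); rewrite intrD. Qed.

(** Pigeonhole: the fractional parts of 0, a, ..., Q a fall into Q boxes of length 1 / Q. Division
    by the gcd makes the fraction reduced and does not increase the error. *)
Lemma dirichlet (R : realType) (a : R) (Q : nat) : (0 < Q)%N ->
  exists (p : int) (q : nat), [/\ (0 < q <= Q)%N, coprime `|p| q &
    `|q%:R * a - p%:~R| < Q%:R^-1].
Proof.
case: Q => // Q _.
have Q0 : 0 < Q.+1%:R :> R by rewrite ltr0n.
pose u (i : nat) : R := i%:R * a - (Num.floor (i%:R * a))%:~R.
have u0 i : 0 <= u i.
  by have /andP[] := floor_bounds (i%:R * a); rewrite /u; lra.
have u1 i : u i < 1.
  by have /andP[] := floor_bounds (i%:R * a); rewrite /u; lra.
pose f (i : 'I_Q.+2) : 'I_Q.+1 := inord `|Num.floor (Q.+1%:R * u i)|.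
have f0 i : (0 <= Num.floor (Q.+1%:R * u i))%R.
  by rewrite real_floor_ge0 ?num_real// mulr_ge0// ltW.
have fE i : (f i : nat) = `|Num.floor (Q.+1%:R * u i)|%N.
  rewrite /f inordK// -ltz_nat gez0_abs// real_floor_lt_int ?num_real//.
  by rewrite -[ltRHS]mulr1 ltr_pM2l.
have /injectivePn[i [j ij fij]] : ~~ injectiveb f.
  by apply/negP => /injectiveP/leq_card; rewrite !card_ord ltnn.
wlog lt_ij : i j ij fij / (i < j)%N.
  move=> h; have := ij; rewrite neq_ltn => /orP[|] lij; first exact: (h i j).
  by apply: (h j i) => //; rewrite eq_sym.
pose q := (j - i)%N; pose p := Num.floor (j%:R * a) - Num.floor (i%:R * a).
have qp : `|q%:R * a - p%:~R| < Q.+1%:R^-1.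
  have -> : q%:R * a - p%:~R = u j - u i.
    by rewrite /u /q /p natrB 1?ltnW// rmorphB /=; ring.
  rewrite -(ltr_pM2l Q0) mulfV ?gt_eqF// -{1}(gtr0_norm Q0) -normrM mulrBr.
  have : Num.floor (Q.+1%:R * u i) = Num.floor (Q.+1%:R * u j).
    by rewrite -[LHS]gez0_abs// -[RHS]gez0_abs// -!fE fij.
  set x := _ * u i; set y := _ * u j => xy.
  have := floor_bounds x; have := floor_bounds y.
  rewrite xy; set z := _%:~R => ? ?.
  by rewrite ltr_norml; lra.
have q0 : (0 < q)%N by rewrite subn_gt0.
have qQ : (q <= Q.+1)%N by have := ltn_ord j; rewrite /q; lia.
pose g := gcdn `|p| q.
have g0 : (0 < g)%N by rewrite gcdn_gt0 q0 orbT.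
have gp : (g %| p)%Z by rewrite dvdzE dvdn_gcdl.
have gq : (g %| q)%N by rewrite dvdn_gcdr.
exists (p %/ g)%Z, (q %/ g)%N; split.
- by rewrite divn_gt0// dvdn_leq//= (leq_trans (leq_div _ _)).
- rewrite /coprime -(eqn_pmul2r g0) muln_gcdl mul1n divnK//.
  by rewrite -[X in (_ * X)%N]absz_nat -abszM divzK.
- apply: le_lt_trans qp.
  have -> : `|q%:R * a - p%:~R| =
      `|(q %/ g * g)%N%:R * a - ((p %/ g)%Z * g)%:~R| by rewrite divnK// divzK.
  rewrite natrM intrM.
  set x := (q %/ g)%:R; set y := (_ %/ _)%Z%:~R.
  rewrite (_ : x * g%:R * a - y * g%:~R = g%:R * (x * a - y)); last by ring.
  by rewrite normrM ler_peMl// ger0_norm ?ler1n.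
Qed.

(** * Upper bound for the edit diameter *)

Section rotation.
Variable R : realType.
Implicit Types (a b x y z w : R) (p : int) (q N : nat).

Lemma val_coding_word a b N x :
  coding_word a b N x = mkseq (fun i => coding a b i%:Z x) N :> seq bool.
Proof. by rewrite /= /mkseq -val_enum_ord -map_comp. Qed.

Lemma codingP a b (i : nat) x : 0 < b < 1 ->
  reflect (exists k : int, 0 <= x + i%:R * a - k%:~R < b) (coding a b i%:Z x).
Proof.
move=> /andP[b0 b1]; rewrite /coding /mod1 in_itv /= -pmulrn.
set z := x + _.
apply: (iffP idP) => [zb|[k]]; first by exists (Num.floor z).
rewrite -/z => /andP[k0 kb]; have := @floor_def R z k.
by rewrite intrD => ->; [rewrite k0 kb|apply/andP; split; lra].
Qed.

(** By Bezout [p] is invertible modulo [q]; take for [s] the residue of [l] times its inverse. *)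
Lemma mulz_residue p q (l : int) : (0 < q)%N -> coprime `|p| q ->
  exists2 s : nat, (s < q)%N & exists k : int, s%:Z * p = l + k * q%:Z.
Proof.
move=> q0 pq; have [u [v uv]] : exists u v : int, u * p + v * q%:Z = 1.
  have [u [v uv]] := Bezoutz p q.
  by exists u, v; rewrite uv /gcdz absz_nat (eqP pq).
have q0' : q%:Z != 0 by lia.
exists `|((l * u) %% q)%Z|%N.
  by rewrite -ltz_nat gez0_abs ?modz_ge0// ltz_mod.
rewrite gez0_abs ?modz_ge0//; exists (- l * v - ((l * u) %/ q)%Z * p).
have -> : ((l * u) %% q)%Z = l * u - ((l * u) %/ q)%Z * q%:Z.
  by rewrite {2}(divz_eq (l * u) q) addrC addKr.
apply/eqP; rewrite -subr_eq0; apply/eqP.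
transitivity (l * (u * p + v * q%:Z - 1)); last by rewrite uv subrr mulr0.
by set d := (_ %/ _)%Z; ring.
Qed.

(** Choose [s] with [s * p] congruent to the floor of [q * (y - x)]: rounding costs at most 1 / q,
    and so does the drift [s * (q * a - p) / q]. *)
Lemma rotation_cover a p q x y : (0 < q)%N -> coprime `|p| q ->
    `|q%:R * a - p%:~R| <= q%:R^-1 ->
  exists2 s : nat, (s < q)%N &
    exists k : int, `|x + s%:R * a - y - k%:~R| <= 2 / q%:R.
Proof.
move=> q0 pq aq; pose l := Num.floor (q%:R * (y - x)).
have [s sq [k sk]] := mulz_residue l q0 pq.
exists s => //; exists k.
have Q0 : 0 < q%:R :> R by rewrite ltr0n.
have -> : x + s%:R * a - y - k%:~R =
    (l%:~R - q%:R * (y - x) + s%:R * (q%:R * a - p%:~R)) / q%:R.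
  have : s%:R * p%:~R = l%:~R + k%:~R * q%:R :> R.
    by have := congr1 (fun t : int => t%:~R : R) sk; rewrite intrD !intrM.
  move=> skR; have -> : l%:~R = s%:R * p%:~R - k%:~R * q%:R :> R.
    by rewrite skR addrK.
  by field; rewrite gt_eqF.
rewrite normrM normfV (gtr0_norm Q0) ler_pM2r ?invr_gt0//.
have := floor_bounds (q%:R * (y - x)); rewrite -/l => lb.
have : `|s%:R * (q%:R * a - p%:~R)| <= 1.
  rewrite normrM ger0_norm// -[leRHS](mulfV (lt0r_neq0 Q0)).
  by rewrite ler_pM// ler_nat ltnW.
by rewrite !ler_norml; lra.
Qed.

Let near a x w q (i : nat) :=
  `[< exists k : int, `|x + i%:R * a - w - k%:~R| <= 2 / q%:R >].

(** With a drift of at most 1 / q, nearness to [w] leaves [C + j i] in [-3, 3], so there are 7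
    values for [j i]. They determine [i < q] because [p] and [q] are coprime. *)
Lemma count_near_block a p q x w : (0 < q)%N -> coprime `|p| q ->
    `|q%:R * a - p%:~R| <= q%:R^-1 ->
  (count (near a x w q) (iota 0 q) <= 7)%N.
Proof.
move=> q0 pq aq; have Q0 : 0 < q%:R :> R by rewrite ltr0n.
pose C := q%:R * (x - w).
pose J := - Num.floor C - 3.
have [kf kfP] : exists kf : nat -> int, forall i, near a x w q i ->
    `|x + i%:R * a - w - (kf i)%:~R| <= 2 / q%:R.
  suff /boolp.choice[kf kfP] : forall i, exists k : int, near a x w q i ->
      `|x + i%:R * a - w - k%:~R| <= 2 / q%:R by exists kf.
  move=> i; have [[k ik]|ni] := pselect (exists k : int,
    `|x + i%:R * a - w - k%:~R| <= 2 / q%:R); first by exists k.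
  by exists 0 => /asboolP.
pose j i := i%:Z * p - kf i * q%:Z.
have jP i : (i < q)%N -> near a x w q i ->
    exists2 t : nat, (t < 7)%N & j i = J + t%:Z.
  move=> iq /kfP; set e := _ - _ => ek.
  have eE : q%:R * e = C + (j i)%:~R + i%:R * (q%:R * a - p%:~R).
    by rewrite /e /C /j intrB !intrM; ring.
  have e2 : `|q%:R * e| <= 2.
    by rewrite normrM (gtr0_norm Q0) mulrC -ler_pdivlMr.
  have : `|i%:R * (q%:R * a - p%:~R)| <= 1.
    rewrite normrM ger0_norm// -[leRHS](mulfV (lt0r_neq0 Q0)).
    by rewrite ler_pM// ler_nat ltnW.
  move: e2; rewrite eE !ler_norml; have := floor_bounds C => Cf h1 h2.
  have lo : (Num.floor C)%:~R + (j i)%:~R < 4 :> R by lra.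
  have hi : - 4 < (Num.floor C)%:~R + (j i)%:~R :> R by lra.
  have {}lo : Num.floor C + j i < 4 by rewrite -(ltr_int R) intrD; lra.
  have {}hi : - 4 < Num.floor C + j i by rewrite -(ltr_int R) intrD; lra.
  exists `|(j i - J)%R|%N; rewrite /J; move: lo hi;
    move: (Num.floor C) (j i) => A B; lia.
rewrite -size_filter; set F := seq.filter _ _.
have jF : {in F &, injective j}.
  move=> i1 i2; rewrite !mem_filter !mem_iota => /andP[_ h1] /andP[_ h2].
  rewrite /j => e.
  have d : (i1%:Z - i2%:Z) * p = (kf i1 - kf i2) * q%:Z by lia.
  have : (q %| `|(i1%:Z - i2%:Z)%R|)%N.
    rewrite -(@Gauss_dvdl _ _ `|p|); last by rewrite coprime_sym.
    by rewrite -abszM d abszM absz_nat dvdn_mull.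
  have [->//|n12] := eqVneq i1 i2.
  by move=> /dvdn_leq; lia.
rewrite -(size_map j).
apply: (@leq_trans (size (map (fun t : nat => J + t%:Z) (iota 0 7)))) => //.
apply: uniq_leq_size.
  by rewrite map_inj_in_uniq// filter_uniq// iota_uniq.
move=> _ /mapP[i + ->]; rewrite mem_filter mem_iota => /andP[ni iq].
have [t t7 ->] := jP i iq ni.
by apply/mapP; exists t => //; rewrite mem_iota.
Qed.

(** Cover [0, N) by N / q + 1 blocks of length [q], each an orbit segment with its own starting
    point. *)
Lemma count_near a p q x w N : (0 < q)%N -> coprime `|p| q ->
    `|q%:R * a - p%:~R| <= q%:R^-1 ->
  (count (near a x w q) (iota 0 N) <= 7 * (N %/ q).+1)%N.
Proof.
move=> q0 pq aq; suff h n x' :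
    (count (near a x' w q) (iota 0 (n * q)) <= 7 * n)%N.
  apply: leq_trans (h _ x); have Nq := ltn_ceil N q0.
  by rewrite -(subnKC (ltnW Nq)) iotaD count_cat leq_addr.
elim: n x' => [//|n IHn] x'; rewrite mulSn iotaD count_cat mulnS leq_add//.
  exact: count_near_block pq aq.
rewrite add0n -[X in iota X]addn0 iotaDl count_map.
apply: leq_trans (IHn (x' + q%:R * a)); apply: sub_count => i /=.
by rewrite /near natrD mulrDl addrA.
Qed.

(** When one of two close points lies in [0, b) and the other does not, one of the ends 0 and b
    separates them. *)
Lemma coding_neq_near a b q x y (s : nat) (k : int) (i : nat) : 0 < b < 1 ->
    `|x + s%:R * a - y - k%:~R| <= 2 / q%:R ->
    coding a b (s + i)%N%:Z x != coding a b i%:Z y ->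
  near a (x + s%:R * a) 0 q i || near a (x + s%:R * a) b q i.
Proof.
move=> b01 xy.
have key z z' : `|z - z'| <= 2 / q%:R -> 0 <= z < b ->
      ~ 0 <= z' < b -> (`|z| <= 2 / q%:R /\ `|z'| <= 2 / q%:R) \/
    (`|z - b| <= 2 / q%:R /\ `|z' - b| <= 2 / q%:R).
  move=> zz' zb nz'.
  have [z'0|z'0] := ltP z' 0; first by
    left; move: zz'; rewrite !ler_norml; split; lra.
  have [z'b|z'b] := ltP z' b; first by exfalso; apply: nz'; rewrite z'0 z'b.
  by right; move: zz'; rewrite !ler_norml; split; lra.
have near0 (l : int) (w : R) :
      `|x + s%:R * a + i%:R * a - w - l%:~R| <= 2 / q%:R ->
    near a (x + s%:R * a) w q i.
  by move=> ?; apply/asboolP; exists l.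
case: (@codingP a b (s + i)%N x b01) => [[l lb]|nl];
    case: (@codingP a b i y b01) => [[l' lb']|nl'] //= _.
- have [|||[h _]|[h _]] := @key (x + (s + i)%:R * a - l%:~R)
    (y + i%:R * a + k%:~R - l%:~R) => //.
  + rewrite natrD; set e := _ - _; rewrite (_ : e = x + s%:R * a - y - k%:~R)//.
    by rewrite /e; ring.
  + by move=> h; apply: nl'; exists (l - k); move: h; rewrite intrB; lra.
  + by rewrite (near0 l 0)//; move: h; rewrite natrD subr0 mulrDl addrA.
  + rewrite orbC (near0 l b)//; move: h; rewrite natrD mulrDl addrA.
    by rewrite (addrAC _ (- b)) .
- have [|||[_ h]|[_ h]] := @key (y + i%:R * a - l'%:~R)
    (x + (s + i)%:R * a - k%:~R - l'%:~R) => //.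
  + rewrite natrD distrC; set e := _ - _.
    rewrite (_ : e = x + s%:R * a - y - k%:~R)//.
    by rewrite /e; ring.
  + by move=> h; apply: nl; exists (k + l'); move: h; rewrite intrD; lra.
  + rewrite (near0 (k + l') 0)//; move: h.
    by rewrite natrD subr0 mulrDl addrA intrD opprD addrA.
  + rewrite orbC (near0 (k + l') b)//; move: h.
    rewrite natrD mulrDl addrA intrD; set e := _ - b; set e' := _ - (_ + _).
    by rewrite (_ : e' = e)// /e /e'; ring.
Qed.

Lemma diam_edit_le a b N M : 0 <= M ->
    (forall x y, 0 <= x < 1 -> 0 <= y < 1 ->
      (edit_count (coding_word a b N x) (coding_word a b N y))%:R <= 2 * M) ->
  diam_edit a b N <= M.
Proof.
move=> M0 h; rewrite /diam_edit; apply/bigmax_leP; split => // -[w w'] /=.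
move=> /andP[ww ww']; case: (set_mem ww) => x + <-.
case: (set_mem ww') => y + <-; rewrite /= !in_itv /= => y01 x01.
by rewrite /edit_dist ler_pdivrMr// mulrC; exact: h.
Qed.

Lemma diam_edit_ge a b N x y : 0 <= x < 1 -> 0 <= y < 1 ->
  edit_dist R (coding_word a b N x) (coding_word a b N y) <= diam_edit a b N.
Proof.
move=> x01 y01; rewrite /diam_edit.
apply: (bigmax_sup (coding_word a b N x, coding_word a b N y)) => //=.
by apply/andP; split; apply/mem_set; [exists x|exists y];
  rewrite //= in_itv.
Qed.

(* Shifting by [s] brings the orbits of [x] and [y] within [2 / q] of each
   other, then the letters differ only when the orbit is near [0] or [b]. *)
Lemma diam_edit_rotation_le a b p q N : (0 < q)%N -> coprime `|p| q ->
    `|q%:R * a - p%:~R| <= q%:R^-1 -> 0 < b < 1 ->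
  diam_edit a b N <= q%:R + 14 * (N%:R / q%:R + 1).
Proof.
move=> q0 pq aq b01; have Q0 : 0 < q%:R :> R by rewrite ltr0n.
have Nq0 : 0 <= N%:R / q%:R :> R by rewrite divr_ge0.
apply: diam_edit_le => [|x y x01 y01].
  by rewrite addr_ge0 ?mulr_ge0 ?addr_ge0.
have [s sq [k xy]] := rotation_cover x y q0 pq aq.
rewrite !val_coding_word.
(* If [s] exceeds [N], replacing the whole word costs at most [2 * N] operations, which is less than
   [2 * q]. *)
have [sN|Ns] := leqP s N; last first.
  have := @edit_count_shift _ (fun i => coding a b i%:Z x)
    (fun i => coding a b i%:Z y) N N (leqnn N).
  rewrite subnn muln0 addn0 -(ler_nat R) => /le_trans; apply.
  rewrite natrM ler_pM2l// (le_trans (y := q%:R))//.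
    by rewrite ler_nat ltnW// (ltn_trans Ns).
  by rewrite lerDl mulr_ge0// addr_ge0.
have := @edit_count_shift _ (fun i => coding a b i%:Z x)
  (fun i => coding a b i%:Z y) N s sN.
set m := count _ _ => le1.
have le2 : (m <= 14 * (N %/ q).+1)%N.
  set x' := x + s%:R * a in xy.
  have le3 : (m <= count (predU (near a x' 0 q) (near a x' b q))
      (iota 0 (N - s)))%N.
    by apply: sub_count => i /(coding_neq_near b01 xy).
  apply: leq_trans le3 _.
  apply: (@leq_trans (count (near a x' 0 q) (iota 0 (N - s)) +
      count (near a x' b q) (iota 0 (N - s)))).
    by rewrite -count_predUI leq_addr.
  (* One 7 for the end 0, one for the end b. *)
  rewrite (_ : 14 = 7 + 7)%N// mulnDl leq_add//;
    apply: leq_trans (count_near _ _ _ q0 pq aq) _;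
    by rewrite leq_mul2l/= ltnS leq_div2r// leq_subr.
have le4 : (N %/ q)%:R <= N%:R / q%:R :> R.
  by rewrite ler_pdivlMr// -natrM ler_nat leq_divM.
have {}le2 : m%:R <= 14 * (N%:R / q%:R + 1) :> R.
  apply: (@le_trans _ _ (14 * (N %/ q).+1)%N%:R); first by rewrite ler_nat.
  by rewrite natrM ler_pM2l// -natr1 lerD2r.
move: le1; rewrite -(ler_nat R) natrD !natrM => /le_trans; apply.
by rewrite -mulrDr ler_pM2l// lerD// ler_nat ltnW.
Qed.

End rotation.

(** * Lower bound for the edit diameter *)

Section phase_arithmetic.
Variable R : realType.
Implicit Types c e th W : R.

(** Here [c] stands for the offset of [Q * b] from an integer and [e] for [Q * eps]. The first
    conclusion places a visit next to 0 for the shift [1 / 2 + th], the second one next to b for a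
    shift by [1 / 2 - th] the other way. For [c <= 0] the ends are exchanged, see
    [phase_window2]. *)
Lemma phase_window1 c e th W : 0 <= c -> c <= 1 / 2 -> 64 * e <= c ->
    - (c / 16) <= th -> th <= c / 16 ->
    1 / 2 + c / 2 - c / 4 <= W -> W <= 1 / 2 + c / 2 - c / 4 + c / 2 ->
  - (1 / 2 + th) <= W - 1 <= - e /\ c - (1 / 2 - th) <= W - 1 / 2 + th <= c - e.
Proof. by move=> *; split; apply/andP; split; lra. Qed.

Lemma phase_window2 c e th W : c <= 0 -> - c <= 1 / 2 -> 64 * e <= - c ->
    - (- c / 16) <= th -> th <= - c / 16 ->
    1 / 2 + c / 2 - - c / 4 <= W -> W <= 1 / 2 + c / 2 - - c / 4 + - c / 2 ->
  c - (1 / 2 + th) <= W - 1 <= c - e /\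
    - (1 / 2 - th) <= W - 1 / 2 + th <= - e.
Proof. by move=> *; split; apply/andP; split; lra. Qed.

Lemma intr_between (n m : int) :
  (m - 1)%:~R < n%:~R :> R -> n%:~R < (m + 1)%:~R :> R -> n = m.
Proof. by rewrite !ltr_int; lia. Qed.

End phase_arithmetic.

Section rotation_lower_bound.
Variables (R : realType) (a b eps Q : R) (p : int) (q : nat).
Hypothesis QE : Q = q%:R.
Hypothesis epsE : eps = Q * a - p%:~R.
Hypotheses (q0 : (0 < q)%N) (pq : coprime `|p| q) (eps0 : 0 < eps).
Hypotheses (b01 : 0 < b < 1) (qb : 2 <= Q * b) (qb' : Q * b <= Q - 2).

Let coded (z : R) := exists k : int, 0 <= z - k%:~R < b.

Let Q0 : 0 < Q. Proof. by rewrite QE ltr0n. Qed.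

Let codedD (z : R) (m : int) : coded (z + m%:~R) <-> coded z.
Proof.
split=> -[k kb]; [exists (k - m)|exists (k + m)];
  by move: kb; rewrite ?intrB ?intrD; lra.
Qed.

Let coded_in (z : R) : 0 <= z < b -> coded z.
Proof. by exists 0; rewrite subr0. Qed.

Let coded_out (z : R) : b - 1 <= z < 0 -> ~ coded z.
Proof.
move=> zb [k kb]; have [k0|k0] := lerP 0 k.
  have : 0 <= k%:~R :> R by rewrite ler0z.
  by move: zb kb; lra.
have : k%:~R <= (-1)%:~R :> R by rewrite ler_int; lia.
by move: zb kb; lra.
Qed.

(* Up to an error [eps], the orbit segment of length [q] started at [u] visits
   all the points [u + l / q]. *)
Let hit (u : R) (l : int) : exists2 r : nat, (r < q)%N & exists k : int,
  Q * u + l%:~R <= Q * (u + r%:R * a - k%:~R) <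
  Q * u + l%:~R + Q * eps.
Proof.
have [r rq [k rk]] := mulz_residue l q0 pq.
exists r => //; exists k.
have : r%:R * p%:~R = l%:~R + k%:~R * Q :> R.
  by have := congr1 (fun t : int => t%:~R : R) rk; rewrite intrD !intrM QE.
move=> rkR; have -> : Q * (u + r%:R * a - k%:~R) =
    Q * u + l%:~R + r%:R * eps.
  have -> : l%:~R = r%:R * p%:~R - k%:~R * Q :> R by rewrite rkR addrK.
  by rewrite epsE; ring.
have : 0 <= r%:R * eps by rewrite mulr_ge0// ltW.
have : r%:R * eps < Q * eps by rewrite QE ltr_pM2r// ltr_nat.
by lra.
Qed.

Section one_shift.
Variables (u t : R).
Hypotheses (t0 : 0 < t).
Hypothesis ut : forall r, (r < q)%N ->
  coded (u + r%:R * a) <-> coded (u + t + r%:R * a).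

(** Points of [-d, 0) are not coded, but [d <= t] carries them past 0 and [t <= b] keeps them below
    b. In [no_hit_b] the points of [b - d, b) leave the coded arc in the same way. *)
Let no_hit_0 (d : R) r (k : int) :
  (r < q)%N -> d <= t -> d <= 1 - b -> t <= b ->
  ~ - d <= u + r%:R * a - k%:~R < 0.
Proof.
have [hb ht] := (b01, t0).
move=> rq dt db tb zd.
have : coded (u + t + r%:R * a - k%:~R) by apply: coded_in; lra.
rewrite -intrN codedD -ut// -(codedD _ (- k)) intrN.
by apply: coded_out; lra.
Qed.

Let no_hit_b (d : R) r (k : int) :
  (r < q)%N -> d <= t -> d <= b -> b + t <= 1 ->
  ~ b - d <= u + r%:R * a - k%:~R < b.
Proof.
have [hb ht] := (b01, t0).
move=> rq dt db tb zd.
have : coded (u + r%:R * a - k%:~R) by apply: coded_in; lra.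
rewrite -intrN codedD ut// -(codedD _ (- k - 1)) intrB intrN.
by apply: coded_out; lra.
Qed.

(** The points found by [hit] are 1 / q apart up to errors below [eps], so an arc of length 1 / q +
    eps contains one. *)
Let hit_gap (z d : R) : 1 + Q * eps <= Q * d ->
  exists2 r : nat, (r < q)%N &
    exists k : int, z - d <= u + r%:R * a - k%:~R < z.
Proof.
move=> qd; have [r rq [k rk]] := hit u (Num.floor (Q * (z - d - u)) + 1).
exists r => //; exists k.
rewrite -(ler_pM2l Q0) -[X in _ && X](ltr_pM2l Q0).
by have := floor_bounds (Q * (z - d - u)); move: rk; rewrite intrD; lra.
Qed.

(** A longer shift would leave a forbidden arc of length at least 1 / q + eps at one end. The end is
    0 if [b >= 1 / 2], as then [t <= b], and b otherwise, as then [b + t <= 1]. *)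
Lemma shift_small : Q * eps <= 1 -> t <= 1 / 2 -> Q * t < 1 + Q * eps.
Proof.
have [[hqb hqb'] ht] := (qb, qb', t0).
move=> qe t2; rewrite ltNge; apply/negP => qt.
have [b2|b2] := lerP (1 / 2) b.
- have [d [db dt qd]] :
    exists d : R, [/\ d <= 1 - b, d <= t & 1 + Q * eps <= Q * d].
    have [tb|bt] := lerP t (1 - b); first by exists t.
    exists (1 - b); split; first by [].
      by lra.
    by rewrite mulrBr mulr1; lra.
  have [r rq [k rk]] := hit_gap 0 qd.
  by apply: (@no_hit_0 d r k) => //; lra.
- have [d [db dt qd]] :
    exists d : R, [/\ d <= b, d <= t & 1 + Q * eps <= Q * d].
    have [tb|bt] := lerP t b; first by exists t.
    by exists b; split => //; lra.
  have [r rq [k rk]] := hit_gap b qd.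
  by apply: (@no_hit_b d r k) => //; lra.
Qed.

(** For such a phase the point found by [hit], with its error below [eps], falls into the forbidden
    arc [-t, 0). *)
Lemma shift_avoids_0 (l : int) : Q * t <= 2 ->
  ~ - (Q * t) <= Q * u + l%:~R <= - (Q * eps).
Proof.
have [hqb hqb'] := (qb, qb').
move=> qt ul; have [r rq [k rk]] := hit u l.
have tb : t <= b by rewrite -(ler_pM2l Q0); lra.
have tb' : t <= 1 - b by rewrite -(ler_pM2l Q0) mulrBr mulr1; lra.
apply: (@no_hit_0 t r k) => //.
by rewrite -(ler_pM2l Q0) -[X in _ && X](ltr_pM2l Q0) mulrN mulr0; lra.
Qed.

Lemma shift_avoids_b (l : int) : Q * t <= 2 ->
  ~ Q * b - Q * t <= Q * u + l%:~R <= Q * b - (Q * eps).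
Proof.
have [hqb hqb'] := (qb, qb').
move=> qt ul; have [r rq [k rk]] := hit u l.
have tb : t <= b by rewrite -(ler_pM2l Q0); lra.
have tb' : t <= 1 - b by rewrite -(ler_pM2l Q0) mulrBr mulr1; lra.
apply: (@no_hit_b t r k) => //; first lra.
by rewrite -(ler_pM2l Q0) -[X in _ && X](ltr_pM2l Q0) mulrBr; lra.
Qed.

End one_shift.

Variables (kb : int) (b0 : R).
Hypotheses (qbE : Q * b = kb%:~R + b0) (b00 : 0 < `|b0|) (b02 : `|b0| <= 1 / 2).
Hypothesis qeb : 64 * (Q * eps) <= `|b0|.

Let W0 := 1 / 2 + b0 / 2 - `|b0| / 4.

(* [W] is the phase of [u] in units of [1 / q]. The shift [t] between the two
   orbits is [+- (1 / 2 +- th) / q]; for either sign the window of phases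
   around [W0 + `|b0| / 4] forces a visit to the arc of length [|t|] next to
   [0] or next to [b], where the two letters differ. *)
Lemma no_match u v (W th : R) (j n : int) :
    (forall r, (r < q)%N -> coded (u + r%:R * a) <-> coded (v + r%:R * a)) ->
    Q * u = W + j%:~R -> W0 <= W <= W0 + `|b0| / 2 ->
    Q * (v - u) = 1 / 2 + th + n%:~R -> `|th| <= `|b0| / 16 -> False.
Proof.
move=> uv quW /andP[WW1 WW2] vu.
rewrite ler_norml => /andP[th1 th2].
have [hb02 hqeb] := (b02, qeb).
have qe : 0 < Q * eps by rewrite mulr_gt0.
have qe1 : Q * eps <= 1 / 4 by move: hb02 hqeb; lra.
have [th1' th2'] : - (1 / 4) < th /\ th < 1 / 4.
  by move: hb02 th1 th2; split; lra.
have [m [t [vE t2 t2']]] : exists m : int, exists t : R,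
    [/\ v = u + t + m%:~R, - (1 / 2) <= t & t <= 1 / 2].
  pose m := Num.floor (v - u + 1 / 2).
  exists m, (v - u - m%:~R); have := floor_bounds (v - u + 1 / 2).
  by rewrite -/m => mP; split; [ring|lra|lra].
pose n' := n - q%:Z * m.
have qt : Q * t = 1 / 2 + th + n'%:~R.
  by rewrite /n' intrB intrM addrA -vu vE (_ : q%:~R = Q) ?QE//; ring.
have [tp|tn|tz] := ltrgt0P t.
- have uvt r : (r < q)%N -> coded (u + r%:R * a) <-> coded (u + t + r%:R * a).
    by move=> rq; rewrite (uv r rq) vE addrAC codedD.
  have qt1 : Q * t < 1 + Q * eps.
    by apply: (shift_small tp uvt _ t2'); apply: le_trans qe1 _; lra.
  have qt0 : 0 < Q * t by rewrite mulr_gt0.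
  (* [shift_small] leaves [Q * t] between 0 and 5 / 4, while [th] is below 1 / 4 in absolute
     value. *)
  have n0 : n' = 0.
    by apply: (@intr_between R); rewrite ?sub0r ?add0r ?intrN; lra.
  rewrite n0 addr0 in qt.
  have qt2 : Q * t <= 2 by rewrite qt; lra.
  have [b0p|b0n] := lerP 0 b0.
  + apply: (@shift_avoids_0 u t tp uvt (- j - 1) qt2).
    move: hb02 hqeb th1 th2 WW1 WW2.
    rewrite /W0 (ger0_norm b0p) => h1 h2 h3 h4 h5 h6.
    have [+ _] := phase_window1 b0p h1 h2 h3 h4 h5 h6.
    by rewrite quW qt intrB intrN addrA addrK.
  + apply: (@shift_avoids_b u t tp uvt (- j + kb - 1) qt2).
    move: hb02 hqeb th1 th2 WW1 WW2.
    rewrite /W0 (ltr0_norm b0n) => h1 h2 h3 h4 h5 h6.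
    have [+ _] := phase_window2 (ltW b0n) h1 h2 h3 h4 h5 h6.
    rewrite quW qt qbE !(intrB, intrD, intrN) => /andP[g1 g2].
    by apply/andP; split; lra.
(* For a negative shift the two orbits exchange their roles, and the length of the shift is
   [1 / 2 - th] in units of 1 / q. *)
- have vut r : (r < q)%N -> coded (v + r%:R * a) <-> coded (v + - t + r%:R * a).
    move=> rq; rewrite -(uv r rq) vE.
    by rewrite (_ : _ + _ + - t + _ = u + r%:R * a + m%:~R) ?codedD//; ring.
  have tp : 0 < - t by rewrite oppr_gt0.
  have tn2 : - t <= 1 / 2 by lra.
  have := shift_small tp vut _ tn2.
  have : 0 < Q * (- t) by rewrite mulr_gt0.
  rewrite mulrN => qt0 /(_ (le_trans qe1 _)) qt1.
  have {}qt1 : - (Q * t) < 1 + Q * eps by apply: qt1; lra.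
  have n0 : n' = -1.
    apply: (@intr_between R).
      by rewrite (_ : (-1 - 1)%:~R = - 2 :> R)//; lra.
    by rewrite (_ : (-1 + 1)%:~R = 0 :> R)//; lra.
  rewrite n0 (_ : (-1)%:~R = -1 :> R) // in qt.
  have qt2 : Q * (- t) <= 2.
    by rewrite mulrN qt; move: th1'; lra.
  have qv : Q * v = W + j%:~R + (1 / 2 + th + n%:~R) by rewrite -quW -vu; ring.
  have [b0p|b0n] := lerP 0 b0.
  + apply: (@shift_avoids_b v (- t) tp vut (- j - n + kb - 1) qt2).
    move: hb02 hqeb th1 th2 WW1 WW2.
    rewrite /W0 (ger0_norm b0p) => h1 h2 h3 h4 h5 h6.
    have [_ +] := phase_window1 b0p h1 h2 h3 h4 h5 h6.
    rewrite qv mulrN qt qbE !(intrB, intrD, intrN) => /andP[g1 g2].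
    by apply/andP; split; lra.
  + apply: (@shift_avoids_0 v (- t) tp vut (- j - n - 1) qt2).
    move: hb02 hqeb th1 th2 WW1 WW2.
    rewrite /W0 (ltr0_norm b0n) => h1 h2 h3 h4 h5 h6.
    have [_ +] := phase_window2 (ltW b0n) h1 h2 h3 h4 h5 h6.
    rewrite qv mulrN qt !(intrB, intrD, intrN) => /andP[g1 g2].
    by apply/andP; split; lra.
(* For [t = 0] the number [1 / 2 + th] would be an integer. *)
- move: qt; rewrite tz mulr0 => h0.
  have [m0|m0] := lerP 0 n'.
    have : 0 <= n'%:~R :> R by rewrite ler0z.
    by lra.
  have : n'%:~R <= (-1)%:~R :> R by rewrite ler_int -ltzD1 addrC subrr.
  by rewrite (_ : (-1)%:~R = -1 :> R)//; lra.
Qed.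

End rotation_lower_bound.

Section separated_words.
Variable R : realType.

(* The marked factors have length [q] and start at the times when the phase
   lies in the window of [no_match]: there are [J] of them in each of [q]
   periods of length [eps^-1]. *)
Lemma diam_edit_rotation_ge (a b b0 : R) (p : int) (q : nat) (k : int) :
    (0 < q)%N -> coprime `|p| q -> 0 < q%:R * a - p%:~R ->
    0 < b < 1 -> 2 <= q%:R * b -> q%:R * b <= q%:R - 2 ->
    q%:R * b = k%:~R + b0 -> 0 < `|b0| -> `|b0| <= 1 / 2 ->
    64 * (q%:R * (q%:R * a - p%:~R)) <= `|b0| ->
  exists N : nat, [/\ q%:R / (q%:R * a - p%:~R) <= N%:R,
    N%:R <= 2 * (q%:R / (q%:R * a - p%:~R)) &
    `|b0| / (32 * (q%:R * a - p%:~R)) <= diam_edit a b N].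
Proof.
have [Q QE] : exists Q : R, Q = q%:R by exists q%:R.
have [e eE] : exists e, e = q%:R * a - p%:~R by exists (q%:R * a - p%:~R).
rewrite -eE -QE => q0 pq e0 b01 qb qb' qbE b00 b02 qeb.
have Q1 : 1 <= Q by rewrite QE ler1n.
have Q0 : 0 < Q by apply: lt_le_trans Q1.
have ei0 : 0 < e^-1 by rewrite invr_gt0.
have e_le : e <= Q * e by rewrite ler_peMl// ltW.
pose W0 := 1 / 2 + b0 / 2 - `|b0| / 4.
have b0n : - `|b0| <= b0 by rewrite lerNl -normrN ler_norm.
have b0p : b0 <= `|b0| by rewrite ler_norm.
(* The phase of [x] starts at the lower end of the window of [no_match]; [y] is half of 1 / q
   ahead. *)
pose x := W0 / Q; pose y := x + 1 / 2 / Q.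
have QxE : Q * x = W0 by rewrite mulrC divfK ?gt_eqF.
have QyE : Q * (y - x) = 1 / 2 by rewrite /y addrC addKr mulrC divfK ?gt_eqF.
have W00 : 0 <= W0 by rewrite /W0; lra.
have W01 : W0 <= 1 by rewrite /W0; lra.
have x01 : 0 <= x < 1.
  apply/andP; split; first by apply: divr_ge0 => //; exact: ltW.
  by rewrite ltr_pdivrMr// mul1r; lra.
have y01 : 0 <= y < 1.
  have -> : y = (W0 + 1 / 2) / Q by rewrite mulrDl.
  apply/andP; split.
    by apply: divr_ge0; [exact: addr_ge0|exact: ltW].
  by rewrite ltr_pdivrMr// mul1r; lra.
(* The first time at which the accumulated drift exceeds [i]: modulo 1 the phase is then back at
   [W0] up to [e]. *)
pose T i := (Num.truncn (i%:R / e)).+1.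
have T_gt i : i%:R / e < (T i)%:R by exact: truncnS_gt.
have T_le i : (T i)%:R <= i%:R / e + 1.
  have /andP[h _] := truncn_itv (divr_ge0 (ler0n R i) (ltW e0)).
  by rewrite /T -natr1 lerD2r.
(* Each block of [q] letters moves the phase by [Q * e], so [J] blocks use at most half of the
   window. *)
pose J := Num.truncn (`|b0| / (4 * (Q * e))).
have bQe0 : 0 <= `|b0| / (4 * (Q * e)).
  by rewrite divr_ge0// mulr_ge0// mulr_ge0// ltW.
have /andP[J_le J_gt] := truncn_itv bQe0; rewrite -/J in J_le J_gt.
have Qe0 : 0 < Q * e by rewrite mulr_gt0.
have J_le' : J%:R * (Q * e) <= `|b0| / 4.
  by move: J_le; rewrite ler_pdivlMr ?mulr_gt0//; lra.
have J_gt' : `|b0| / 8 <= J%:R * (Q * e).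
  move: J_gt; rewrite ltr_pdivrMr ?mulr_gt0// -natr1.
  by move: qeb; lra.
pose pos m := (T (m %/ J) + (m %% J) * q)%N.
pose N := (q * (T 1))%N.
have N_ge : Q / e <= N%:R.
  by rewrite /N natrM -QE ler_pM2l// (le_trans _ (ltW (T_gt 1%N)))// mul1r.
have e1 : 1 <= e^-1.
  rewrite -[leLHS]invr1 lef_pV2 ?posrE//.
  by move: e_le qeb b02; lra.
have N_le : N%:R <= 2 * (Q / e).
  rewrite /N natrM -QE mulrCA ler_pM2l//.
  by have := T_le 1%N; rewrite mul1r; lra.
exists N; split => //.
apply: le_trans (diam_edit_ge a b N x01 y01).
rewrite !val_coding_word /edit_dist.
set n := edit_count _ _.
suff n_ge : `|b0| / (16 * e) <= n%:R.
  rewrite ler_pdivlMr//; apply: le_trans n_ge.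
  by rewrite le_eqVlt; apply/orP; left; apply/eqP; field; rewrite gt_eqF.
rewrite leNgt; apply/negP => n_lt.
have Ee1 : e * e^-1 = 1 by rewrite mulfV// gt_eqF.
have J0 : (0 < J)%N.
  rewrite -(ltr_nat R) -(ltr_pM2r Qe0) mul0r; apply: lt_le_trans J_gt'.
  by rewrite divr_gt0.
have JQ : J%:R * Q <= `|b0| / 4 * e^-1.
  by rewrite -(ler_pM2r e0) -!mulrA [e^-1 * e]mulrC Ee1 mulr1.
have bE : `|b0| * e^-1 <= 1 / 2 * e^-1 by rewrite ler_pM2r.
have e128 : 128 * e <= 1 by move: e_le qeb b02; lra.
have E128 : 128 <= e^-1.
  by rewrite -(ler_pM2l e0) Ee1 mulrC.
have JQ1 : 1 + J%:R * Q <= e^-1 by move: JQ bE E128; lra.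
have row k1 k2 : (k1 < k2)%N -> (T k1)%:R + J%:R * Q <= k2%:R / e.
  move=> k12; have := T_le k1.
  have : k1%:R / e + e^-1 <= k2%:R / e.
    by rewrite -[X in _ + X]mul1r -mulrDl natr1 ler_pM2r// ler_nat.
  by move: JQ1; lra.
have gap m m' : (m < m')%N -> (pos m + q <= pos m')%N.
  move=> mm'; rewrite /pos.
  have := leq_div2r J (ltnW mm'); rewrite leq_eqVlt => /orP[/eqP kk|kk].
    have jj : (m %% J < m' %% J)%N.
      by move: mm'; rewrite {1}(divn_eq m J) {1}(divn_eq m' J) kk ltn_add2l.
    by rewrite kk -addnA leq_add2l -mulSnr leq_mul2r jj orbT.
  have jJ : (m %% J < J)%N by rewrite ltn_mod.
  apply: leq_trans (leq_addr _ _).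
  rewrite -addnA -mulSnr -(ler_nat R); apply: le_trans (ltW (T_gt _)).
  apply: le_trans (row _ _ kk); rewrite natrD natrM -QE lerD2l ler_pM2r//.
  by rewrite ler_nat.
have pos_le m : (m < q * J)%N -> (pos m + q <= N)%N.
  move=> mq; have kq : (m %/ J < q)%N by rewrite ltn_divLR.
  have jJ : (m %% J < J)%N by rewrite ltn_mod.
  rewrite -(ler_nat R); apply: le_trans N_ge; rewrite QE.
  apply: le_trans (row _ _ kq); rewrite /pos -addnA -mulSnr natrD natrM -QE.
  by rewrite lerD2l ler_pM2r// ler_nat.
have nc : (n < q * J)%N.
  rewrite -(ltr_nat R); apply: lt_le_trans n_lt _.
  rewrite natrM -QE -(ler_pM2r e0) (_ : `|b0| / (16 * e) * e = `|b0| / 16).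
    by move: J_gt' b00; lra.
  by field; rewrite gt_eqF.
have [|||_ /mapP[m + ->]] := @edit_ops_survive _ false q n _ _
    (map pos (iota 0 (q * J))) (edit_countP _ _).
- rewrite pairwise_map; apply: (@sub_pairwise _ ltn) => [m m' /gap//|].
  by rewrite -sorted_pairwise ?iota_ltn_sorted//; exact: ltn_trans.
- apply/allP => _ /mapP[m + ->]; rewrite mem_iota size_mkseq => /andP[_].
  exact: pos_le.
- by rewrite size_map size_iota.
rewrite mem_iota add0n => mq [j [ij ji jN match_ij]].
rewrite size_mkseq in jN; have iN := pos_le m mq.
set i := pos m in ij ji iN match_ij.
have phase : W0 <= W0 + (i%:R * e - (m %/ J)%N%:R) <= W0 + `|b0| / 2.
  rewrite lerDl lerD2l /i /pos natrD natrM -QE.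
  set k1 := (m %/ J)%N.
  have h1 : k1%:R < (T k1)%:R * e by rewrite -ltr_pdivrMr.
  have h2 : (T k1)%:R * e <= k1%:R + e.
    rewrite -ler_pdivlMr// mulrDl mulfV ?gt_eqF//.
  have h3 : (m %% J)%N%:R * (Q * e) <= J%:R * (Q * e).
    by rewrite ler_pM2r// ler_nat ltnW// ltn_mod.
  have h4 : 0 <= (m %% J)%N%:R * (Q * e) by rewrite mulr_ge0// ltW.
  by apply/andP; split; move: h1 h2 h3 h4 J_le' e_le qeb; lra.
have eE' : e = Q * a - p%:~R by rewrite QE.
(* The surviving factor has moved by at most [n] places, and n < |b0| / (16 e), so the phases still
   differ by 1 / 2 up to |b0| / 16. *)
apply: (@no_match R a b e Q p q QE eE' q0 pq e0 b01 qb qb' k b0 qbE b02 qeb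
  (x + i%:R * a) (y + j%:R * a) (W0 + (i%:R * e - (m %/ J)%N%:R))
  ((j%:R - i%:R) * e) ((m %/ J)%N%:Z + i%:Z * p) ((j%:Z - i%:Z) * p)) => //.
- move=> r rq /=.
  have ir : (i + r < N)%N by apply: leq_trans iN; rewrite ltn_add2l.
  have jr : (j + r < N)%N by apply: leq_trans jN; rewrite ltn_add2l.
  have := match_ij r rq; rewrite !nth_mkseq// => cji.
  rewrite -(addrA x) -(addrA y) -!mulrDl -!natrD.
  have P1 := @codingP R a b (i + r)%N x b01.
  have P2 := @codingP R a b (j + r)%N y b01.
  split=> h.
    by apply: (elimT P2); rewrite cji; exact: (introT P1).
  by apply: (elimT P1); rewrite -cji; exact: (introT P2).
- by rewrite mulrDr QxE intrD intrM -!pmulrn eE'; ring.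
- have -> : y + j%:R * a - (x + i%:R * a) = y - x + (j%:R - i%:R) * a by ring.
  by rewrite mulrDr QyE intrM intrB -!pmulrn eE'; ring.
- rewrite normrM (gtr0_norm e0) -ler_pdivlMr//.
  apply: (@le_trans _ _ n%:R); last first.
    by apply: ltW; apply: lt_le_trans n_lt _; rewrite invfM mulrA.
  rewrite ler_norml; move: ij ji; rewrite -!(ler_nat R) !natrD.
  by move=> h1 h2; apply/andP; split; lra.
Qed.

End separated_words.

(** * Hausdorff measure *)

Local Open Scope classical_set_scope.
Local Open Scope ring_scope.

(** * Integer square roots, for an enumeration of the fractions *)

Section nat_square_root.
Local Open Scope nat_scope.
Implicit Types n p q r : nat.

Lemma nat_sqrt_exists n : exists q, q * q <= n < q.+1 * q.+1.
Proof.
elim: n => [|n [q qn]]; first by exists 0.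
have [h|h] := ltnP n.+1 (q.+1 * q.+1); first by exists q; lia.
by exists q.+1; nia.
Qed.

Lemma nat_sqrt_gt0 r n : 0 < n -> n < r.+1 * r.+1 -> 0 < r.
Proof. by case: r => //; lia. Qed.

Lemma nat_sqrt_bound r n : 0 < r -> n < r.+1 * r.+1 -> n <= 4 * r ^ 2.
Proof. by rewrite -mulnn; nia. Qed.

Lemma nat_sqrt_unique r p q : p <= q ->
  r * r <= q * q + p < r.+1 * r.+1 -> r = q.
Proof. by move=> pq /andP[h1 h2]; nia. Qed.

End nat_square_root.

(** * Criteria for null and for positive Hausdorff measure *)

Section hausdorff_bounds.
Variable R : realType.
Implicit Types (U E : set R) (s D C x y : R).

Lemma ediam_le U D : (forall x y, U x -> U y -> `|x - y| <= D) ->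
  (ediam U <= D%:E)%E.
Proof.
move=> UD; apply: ge_ereal_sup => _ [[x y] [/= Ux Uy] <-].
by rewrite lee_fin UD.
Qed.

Lemma ediam_ge U x y : U x -> U y -> (`|x - y|%:E <= ediam U)%E.
Proof. by move=> Ux Uy; apply: ereal_sup_ubound; exists (x, y). Qed.

Lemma ediam_ge0 U : U !=set0 -> (0 <= ediam U)%E.
Proof. by case=> x Ux; have := ediam_ge Ux Ux; rewrite subrr normr0. Qed.

Lemma ediam_pow_ge0 s U : (0 <= ediam_pow s U)%E.
Proof. by rewrite /ediam_pow; case: ifP => // _; exact: poweR_ge0. Qed.

Lemma ediam_pow_le s U D : 0 <= s -> 0 <= D ->
  (forall x y, U x -> U y -> `|x - y| <= D) -> (ediam_pow s U <= (D `^ s)%:E)%E.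
Proof.
move=> s0 D0 UD; rewrite /ediam_pow; case: ifPn => [_|/set0P/ediam_ge0 U0].
  by rewrite lee_fin powR_ge0.
rewrite -poweR_EFin; apply: gt0_ler_poweR => //; last exact: ediam_le.
- by rewrite in_itv/= U0 leey.
- by rewrite in_itv/= lee_fin D0 leey.
Qed.

Lemma hausdorff_content_le s delta E : 0 < delta ->
  (hausdorff_content s delta E <= hausdorff_measure s E)%E.
Proof.
move=> d0; apply: ereal_sup_ubound; exists delta => //=.
by rewrite in_itv/= d0.
Qed.

Lemma hausdorff_content_ge0 s delta E : (0 <= hausdorff_content s delta E)%E.
Proof.
apply: le_ereal_inf_tmp => _ [U _ <-].
by apply: nneseries_ge0 => k _ _; exact: ediam_pow_ge0.
Qed.

Lemma hausdorff_measure_ge0 s E : (0 <= hausdorff_measure s E)%E.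
Proof.
apply: le_trans (hausdorff_content_le s E ltr01).
exact: hausdorff_content_ge0.
Qed.

Lemma hausdorff_measure_eq0 s E :
    (forall d e, 0 < d -> 0 < e -> exists U : (set R)^nat,
      [/\ E `<=` \bigcup_k U k, forall k, (ediam (U k) <= d%:E)%E &
        (\sum_(k <oo) ediam_pow s (U k) <= e%:E)%E]) ->
  hausdorff_measure s E = 0%E.
Proof.
move=> h; apply/eqP; rewrite eq_le hausdorff_measure_ge0 andbT.
apply: ge_ereal_sup => _ [d /= + <-]; rewrite in_itv/= andbT => d0.
apply/lee_addgt0Pr => e e0; rewrite add0e.
have [U [EU Ud Ue]] := h d e d0 e0.
by apply: le_trans Ue; apply: ereal_inf_lbound; exists U.
Qed.

(* The inverse of [g] is s-Hoelder: a cover of [E] pulls back to a cover of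
   [[0, 1)], to which Lebesgue subadditivity applies. *)
Lemma hausdorff_measure_holder s C E (g : R -> R) : 0 <= s -> 0 < C ->
    (forall x, 0 <= x < 1 -> E (g x)) ->
    (forall x y, 0 <= x < 1 -> 0 <= y < 1 ->
      `|x - y| <= C * `|g x - g y| `^ s) ->
  hausdorff_measure s E != 0%E.
Proof.
move=> s0 C0 Eg gC; apply/negP => /eqP H0.
(* The intervals [W k] below will have total length at most [2 * C] times this sum, hence less than
   1 / 2. *)
have : (hausdorff_content s 1 E < (4 * C)^-1%:E)%E.
  apply: (le_lt_trans (hausdorff_content_le s E ltr01)).
  by rewrite H0 lte_fin invr_gt0 mulr_gt0.
move=> /ereal_inf_lt[_ [U [EU U1] <-]] sumU.
pose V k := [set x | 0 <= x < 1 /\ U k (g x)].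
have [c cP] : exists c : nat -> R, forall k, V k !=set0 -> V k (c k).
  suff /boolp.choice[c cP] : forall k, exists c, V k !=set0 -> V k c.
    by exists c.
  by move=> k; have [[x Vx]|V0] := pselect (V k !=set0); [exists x|exists 0].
pose D k := C * fine (ediam_pow s (U k)).
(* A measurable set containing the preimage [V k]: an interval around one of its points. *)
pose W k :=
  if pselect (V k !=set0) then `[c k - D k, c k + D k]%classic else set0.
have U_fin k : U k !=set0 -> ediam (U k) \is a fin_num.
  by move=> Uk; rewrite ge0_fin_numE ?ediam_ge0// (le_lt_trans (U1 k))// ltry.
have pow_fin k : ediam_pow s (U k) \is a fin_num.
  rewrite /ediam_pow; case: ifPn => // /set0P Uk.
  by rewrite fin_num_poweR// U_fin.
have VW k x : V k x -> W k x.
  move=> Vx; rewrite /W; case: pselect => /= [V0|]; last by case; exists x.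
  have [c01 Uc] := cP k V0; have [x01 Ux] := Vx.
  rewrite in_itv/=; suff : `|x - c k| <= D k by rewrite ler_distl.
  apply: le_trans (gC _ _ x01 c01) _; rewrite /D ler_pM2l//.
  have Uk : U k !=set0 by exists (g x).
  rewrite /ediam_pow ifF; last by apply/negbTE/set0P.
  rewrite -[ediam (U k)]fineK ?U_fin// poweR_EFin/=; apply: ge0_ler_powR => //.
  - by rewrite nnegrE fine_ge0// ediam_ge0.
  - by rewrite -lee_fin fineK ?U_fin// ediam_ge.
have mW k : measurable (W k).
  rewrite /W; case: pselect => [?|?] /=; last exact: measurable0.
  exact: measurable_itv.
have D0 k : 0 <= D k.
  by apply: mulr_ge0; [exact: ltW|apply: fine_ge0; exact: ediam_pow_ge0].
have W_le k : (lebesgue_measure (W k) <= (2 * C)%:E * ediam_pow s (U k))%E.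
  rewrite -[ediam_pow s (U k)]fineK// -EFinM -mulrA -/(D k) /W.
  case: pselect => [?|?] /=; last by rewrite measure0 lee_fin mulr_ge0.
  rewrite lebesgue_measure_itv/=; case: ifP => _; last first.
    by rewrite lee_fin mulr_ge0.
  by rewrite -EFinB lee_fin; lra.
have cover : `[0, 1[ `<=` \bigcup_k W k.
  move=> x; rewrite /= in_itv/= => x01.
  by have [k _ Ux] := EU _ (Eg x x01); exists k => //; exact: VW.
have : (lebesgue_measure (`[0%R, 1%R[ : set R) <=
    \sum_(k <oo) lebesgue_measure (W k))%E.
  by apply: measure_sigma_subadditive => //; exact: measurable_itv.
have -> : lebesgue_measure (`[0, 1[ : set R) = 1%E.
  by rewrite lebesgue_measure_itv/= lte_fin ltr01 sube0.
rewrite leNgt => /negP; apply.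
apply: (@le_lt_trans _ _ ((2 * C)%:E * \sum_(k <oo) ediam_pow s (U k))%E).
  rewrite -nneseriesZl; last by move=> *; exact: ediam_pow_ge0.
  by apply: lee_nneseries => // *; exact: measure_ge0.
apply: (@lt_trans _ _ ((2 * C)%:E * (4 * C)^-1%:E)%E).
  by rewrite lte_pmul2l// lte_fin mulr_gt0.
rewrite -EFinM lte_fin (_ : _ * _ = 1 / 2); first lra.
by field; rewrite gt_eqF.
Qed.

Lemma hausdorff_dim_ge E s0 :
    (forall s, 0 <= s < s0 -> hausdorff_measure s E != 0%E) ->
  (s0%:E <= hausdorff_dim E)%E.
Proof.
move=> h; apply: le_ereal_inf_tmp => _ [s [/= s_ge0 Hs] <-].
rewrite lee_fin leNgt; apply/negP => ss0.
by have := h s; rewrite s_ge0 ss0 Hs eqxx => /(_ isT).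
Qed.

Lemma hausdorff_dim_le E s0 : 0 <= s0 ->
    (forall s, s0 < s -> hausdorff_measure s E = 0%E) ->
  (hausdorff_dim E <= s0%:E)%E.
Proof.
move=> s00 h; apply/lee_addgt0Pr => e e0.
apply: ereal_inf_lbound; exists (s0 + e) => //=; split.
  by rewrite addr_ge0 // ltW.
by apply: h; rewrite ltrDl.
Qed.

(** A discrete form of the derivative of x^(-t). The factor 4 pays for the estimates ln (1 + y) >= y
    / 2 and exp (-z) <= 1 / (1 + z). *)
Lemma powR_telescope (t x : R) : 0 < t -> t <= 1 -> 1 <= x ->
  x `^ (- (1 + t)) <= 4 / t * (x `^ (- t) - (x + 1) `^ (- t)).
Proof.
move=> t0 t1 x1; have x0 : 0 < x by lra.
have -> : (x + 1) `^ (- t) = x `^ (- t) * (1 + x^-1) `^ (- t).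
  rewrite -powRM ?ltW ?addr_gt0 ?invr_gt0//; congr (_ `^ _).
  by field; rewrite gt_eqF.
have -> : x `^ (- (1 + t)) = x `^ (- t) * x^-1.
  rewrite -[x^-1]powR_inv1 ?ltW// -powRD; last first.
    by apply/implyP => _; rewrite gt_eqF.
  by congr (_ `^ _); ring.
set y := x^-1; have y0 : 0 < y by rewrite invr_gt0.
have y1 : y <= 1 by rewrite -[leRHS]invr1 lef_pV2 ?posrE.
rewrite -{2}[x `^ (- t)]mulr1 -mulrBr mulrCA ler_pM2l ?powR_gt0//.
suff : (1 + y) `^ (- t) <= 1 - t * y / 4.
  move=> h; rewrite mulrAC ler_pdivlMr//; lra.
have y10 : 0 < 1 + y by lra.
have lny : y / 2 <= ln (1 + y).
  have := @le_ln1Dx R ((1 + y)^-1 - 1).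
  rewrite [1 + (_ - 1)]addrC subrK lnV ?posrE// => /(_ _).
  have : (1 + y)^-1 <= 1 - y / 2.
    by rewrite -[(1 + y)^-1]mul1r ler_pdivrMr//; nra.
  have : 0 < (1 + y)^-1 by rewrite invr_gt0.
  move=> h1 h2 h3; have : - ln (1 + y) <= (1 + y)^-1 - 1 by apply: h3; lra.
  by lra.
rewrite /powR gt_eqF//.
apply: (@le_trans _ _ (expR (- (t * (y / 2))))).
  by rewrite ler_expR mulNr lerN2 ler_pM2l.
rewrite expRN; set z := t * (y / 2).
have z0 : 0 < z by rewrite mulr_gt0 ?divr_gt0.
have z1 : z <= 1 by rewrite /z; nra.
apply: (@le_trans _ _ (1 + z)^-1).
  by rewrite lef_pV2 ?posrE ?expR_gt0 ?expR_ge1Dx//; lra.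
rewrite -[leLHS]mul1r ler_pdivrMr; last lra.
have -> : t * y / 4 = z / 2 by rewrite /z; field.
by nra.
Qed.

Lemma series_telescope_le (u v : R^nat) : (forall k, 0 <= u k) ->
    (forall k, 0 <= v k) -> (forall k, u k <= v k - v k.+1) ->
  (\sum_(k <oo) (u k)%:E <= (v 0%N)%:E)%E.
Proof.
move=> u0 v0 uv; apply: lime_le.
  by apply: is_cvg_nneseries => k _ _; rewrite lee_fin.
apply: nearW => n; rewrite sumEFin lee_fin.
apply: (@le_trans _ _ (v 0%N - v n)); last by rewrite gerBl.
elim: n => [|n IHn]; first by rewrite big_nil subrr.
by rewrite big_nat_recr//=; have := uv n; move: IHn; lra.
Qed.

(* The fractions [p / q] with [p <= q] are enumerated by [n = q * q + p], so
   that the series to be bounded is single and decays like [n ^ (- kappa * s /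
   2)]. *)
Lemma hausdorff_measure_limsup s kappa E : 0 < s -> 1 <= kappa ->
    2 < kappa * s ->
    (forall a, E a -> forall Q0 : nat, exists q p : nat,
      [/\ (Q0 <= q)%N, (p <= q)%N & `|a - p%:R / q%:R| <= q%:R `^ (- kappa)]) ->
  hausdorff_measure s E = 0%E.
Proof.
move=> s0 kappa1 ks2 Eapprox.
have [rt rtP] := boolp.choice nat_sqrt_exists.
(* As n <= 4 q^2, the inequality 2 (1 + t) <= kappa s bounds q^(- kappa s) by a multiple of n^(- (1
   + t)); [powR_telescope] asks for [t <= 1]. *)
pose t := Num.min 1 (kappa * s / 2 - 1).
have t0 : 0 < t by rewrite lt_min ltr01 /=; lra.
have t1 : t <= 1 by rewrite ge_min lexx.
have tks : 2 * (1 + t) <= kappa * s.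
  have : t <= kappa * s / 2 - 1 by rewrite ge_min lexx orbT.
  by lra.
pose A := 2 `^ s * 4 `^ (1 + t).
have A0 : 0 < A by rewrite mulr_gt0// powR_gt0.
pose B := A * (4 / t).
have B0 : 0 < B by rewrite mulr_gt0// divr_gt0.
apply: hausdorff_measure_eq0 => d e d0 e0.
(* The first summand makes all diameters at most [d], the second makes the telescoped sum at most
   [e]. *)
pose N0 := (Num.truncn (16 / d ^+ 2 + (e / B) `^ (- t^-1))).+1.
have N0_gt : 16 / d ^+ 2 + (e / B) `^ (- t^-1) < N0%:R by exact: truncnS_gt.
have d2 : 0 < d ^+ 2 by rewrite exprn_gt0.
have eB : 0 < (e / B) `^ (- t^-1) by rewrite powR_gt0// divr_gt0.
have dd : 0 < 16 / d ^+ 2 by rewrite divr_gt0.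
pose q n := rt (n + N0)%N; pose p n := (n + N0 - q n * q n)%N.
pose r n := (q n)%:R `^ (- kappa) : R.
pose U n := [set x | `|x - (p n)%:R / (q n)%:R| <= r n].
have r0 n : 0 <= r n by rewrite powR_ge0.
have q_gt0 n : (0 < q n)%N.
  have /andP[_] := rtP (n + N0)%N; apply: nat_sqrt_gt0.
  by rewrite /N0 addnS.
have q1 n : 1 <= (q n)%:R :> R by rewrite ler1n.
have qN n : (n + N0)%:R <= 4 * (q n)%:R ^+ 2 :> R.
  rewrite -natrX -natrM ler_nat.
  have /andP[_] := rtP (n + N0)%N; apply: nat_sqrt_bound; exact: q_gt0.
have UD n x y : U n x -> U n y -> `|x - y| <= 2 * r n.
  rewrite /U/= => h1 h2.
  rewrite (_ : x - y = (x - (p n)%:R / (q n)%:R) - (y - (p n)%:R / (q n)%:R)).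
    by apply: le_trans (ler_normB _ _) _; lra.
  by ring.
have rle n : 2 * r n <= d.
  apply: (@le_trans _ _ (2 * (q n)%:R^-1)).
    by rewrite ler_pM2l// -powR_inv1// ler_powR// lerN2.
  rewrite ler_pdivrMr; last by apply: lt_le_trans (q1 n).
  rewrite mulrC -ler_pdivrMr// -ler_sqr ?nnegrE ?divr_ge0 ?(ltW d0)//.
  rewrite expr_div_n; have := qN n; rewrite natrD.
  have : 0 <= n%:R :> R by [].
  have -> : 2 ^+ 2 / d ^+ 2 = 16 / d ^+ 2 / 4 :> R by field; rewrite gt_eqF.
  by lra.
have Upow n : (ediam_pow s (U n) <=
    (B * ((n + N0)%:R `^ (- t) - (n.+1 + N0)%:R `^ (- t)))%:E)%E.
  have rn2 : 0 <= 2 * r n by rewrite mulr_ge0.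
  apply: le_trans (ediam_pow_le (ltW s0) rn2 (@UD n)) _; rewrite lee_fin.
  have n1 : 1 <= (n + N0)%:R :> R by rewrite ler1n addnS.
  apply: (@le_trans _ _ (A * (n + N0)%:R `^ (- (1 + t)))); last first.
    rewrite /B -mulrA ler_pM2l// addSn -[(n + N0).+1%:R]natr1.
    exact: powR_telescope.
  rewrite powRM// /A -mulrA ler_pM2l ?powR_gt0//.
  rewrite /r -powRrM.
  apply: (@le_trans _ _ ((q n)%:R `^ (- (2 * (1 + t))))).
    by rewrite ler_powR// mulNr lerN2.
  rewrite -mulrN powRrM powR_mulrn//.
  have q20 : 0 < (q n)%:R ^+ 2 :> R by rewrite exprn_gt0// (lt_le_trans ltr01).
  rewrite !powRN ler_pdivlMr ?powR_gt0 ?(lt_le_trans ltr01)//.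
  rewrite mulrC ler_pdivrMr ?powR_gt0//.
  rewrite -powRM ?(ltW q20)//; apply: ge0_ler_powR.
  - by rewrite addr_ge0// ltW.
  - by rewrite nnegrE.
  - by rewrite nnegrE mulr_ge0// ltW.
  - exact: qN.
exists U; split.
- move=> a /Eapprox/(_ N0)[q' [p' [Nq' pq' ap']]].
  exists (q' * q' + p' - N0)%N => //; rewrite /U/= /r /p /q.
  rewrite subnK; last first.
    apply: (leq_trans Nq'); apply: (leq_trans _ (leq_addr _ _)).
    by case: (q') => // k; rewrite mulSn leq_addr.
  by rewrite (nat_sqrt_unique pq' (rtP _)) addnC addnK.
- move=> n; apply: ediam_le => x y Ux Uy.
  by apply: le_trans (rle n); exact: UD Ux Uy.
apply: (@le_trans _ _ (\sum_(k <oo)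
    (B * ((k + N0)%:R `^ (- t) - (k.+1 + N0)%:R `^ (- t)))%:E)%E).
  by apply: lee_nneseries => // *; exact: ediam_pow_ge0.
apply: (@le_trans _ _ (B * (0 + N0)%:R `^ (- t))%:E).
  apply: (@series_telescope_le _ (fun k => B * (k + N0)%:R `^ (- t))) => k.
  - by rewrite -lee_fin; apply: le_trans (Upow k); exact: ediam_pow_ge0.
  - by rewrite mulr_ge0 ?powR_ge0// ltW.
  - by rewrite mulrBr.
rewrite lee_fin mulrC -ler_pdivlMr// add0n.
have eB0 : 0 < e / B by rewrite divr_gt0.
have -> : e / B = ((e / B) `^ (- t^-1)) `^ (- t).
  rewrite -powRrM mulrNN mulVf ?gt_eqF// powRr1//.
  exact: ltW.
rewrite !(powRN _ t) lef_pV2 ?posrE ?powR_gt0 ?ltr0n//.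
apply: ge0_ler_powR; first exact: ltW.
- by rewrite nnegrE powR_ge0.
- by rewrite nnegrE.
- by lra.
Qed.

End hausdorff_bounds.

(** * A Cantor set of numbers with prescribed rational approximations *)

(** The difference multiplied by [q * q'] is a nonzero integer. *)
Lemma fraction_separation (R : realType) (p p' : int) (q q' : nat) :
    (0 < q)%N -> (0 < q')%N -> p%:~R / q%:R != p'%:~R / q'%:R :> R ->
  (q%:R * q'%:R)^-1 <= `|p%:~R / q%:R - p'%:~R / q'%:R| :> R.
Proof.
move=> q0 q'0 pq.
have Q0 : 0 < q%:R :> R by rewrite ltr0n.
have Q'0 : 0 < q'%:R :> R by rewrite ltr0n.
have -> : p%:~R / q%:R - p'%:~R / q'%:R =
    (p * q'%:Z - p' * q%:Z)%:~R / (q%:R * q'%:R) :> R.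
  rewrite intrB !intrM -!pmulrn; field.
  by rewrite !gt_eqF.
rewrite normrM normfV (gtr0_norm (mulr_gt0 Q0 Q'0)).
rewrite ler_peMl ?invr_ge0 ?(ltW (mulr_gt0 Q0 Q'0))//.
rewrite -intr_norm ler1z; apply: contraNT pq => h.
have {}h : p * q'%:Z = p' * q%:Z by lia.
rewrite eqr_div ?lt0r_neq0//; apply/eqP.
by have := congr1 (fun t : int => t%:~R : R) h; rewrite !intrM.
Qed.

(** * Intervals that avoid fractions *)

Section good_intervals.
Variables (R : realType) (phi : R -> R) (K c : R).

(* The fractions with denominator at most [h] may be approximated up to [phi],
   the others are badly approximable; only denominators up to [sqrt (K / l)]
   are seen at the scale [l]. *)
Definition good (a l h : R) := forall (x : R) (p : int) (q : nat),
  a <= x <= a + l -> (0 < q)%N -> q%:R ^+ 2 * l <= K ->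
  (q%:R <= h -> phi q%:R <= `|x - p%:~R / q%:R|) /\
  (h < q%:R -> c / q%:R ^+ 2 <= `|x - p%:~R / q%:R|).

Variable m : nat.
Let M : R := m%:R.
Hypothesis m0 : (0 < m)%N.
(** With this [K], two denominators visible at the next scale l / (8 M) have a product of at most 1
    / (2 l). With this [c], the zone around a fraction not visible at the scale [l] is small
    compared to [l]. *)
Hypotheses (KM : K * (16 * M) = 1) (KE : K = 512 * c).
Hypothesis phi_le : forall t : R, 1 <= t -> phi t <= c / t ^+ 2.

Let M1 : 1 <= M. Proof. by rewrite ler1n. Qed.
Let M0 : 0 < M. Proof. exact: lt_le_trans M1. Qed.
Let M16 : 0 < 16 * M. Proof. exact: mulr_gt0. Qed.
Let K0 : 0 < K. Proof. by rewrite -(pmulr_lgt0 _ M16) KM. Qed.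
Let c0 : 0 < c. Proof. by have := K0; rewrite KE; lra. Qed.

(* The fractions with denominators between [sqrt (K / l)] and [sqrt (8 M K /
   l)] are [2 l] apart, so at most one of them is close to the interval and
   one of the outer quarters avoids it. *)
Lemma good_quarter a l h : 0 < l -> good a l h ->
  exists b : R, [/\ a <= b, b + l / 4 <= a + l &
    forall x (p : int) (q : nat), b <= x <= b + l / 4 -> (0 < q)%N ->
      q%:R ^+ 2 * (l / (8 * M)) <= K -> K < q%:R ^+ 2 * l ->
      c / q%:R ^+ 2 <= `|x - p%:~R / q%:R|].
Proof.
have [[hM1 hM0 hK0] hKE] := (And3 M1 M0 K0, KE).
move=> l0 _.
have cq (q : nat) : K < q%:R ^+ 2 * l -> c / q%:R ^+ 2 <= l / 4.
  move=> Kq; have q20 : 0 < q%:R ^+ 2 :> R.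
    by rewrite -(pmulr_lgt0 _ l0) (lt_trans K0).
  by rewrite ler_pdivrMr//; move: hKE; lra.
have sep (p p' : int) (q q' : nat) : (0 < q)%N -> (0 < q')%N ->
    q%:R ^+ 2 * (l / (8 * M)) <= K -> q'%:R ^+ 2 * (l / (8 * M)) <= K ->
    p%:~R / q%:R != p'%:~R / q'%:R :> R ->
    2 * l <= `|p%:~R / q%:R - p'%:~R / q'%:R| :> R.
  move=> q0 q'0 qK q'K /(fraction_separation q0 q'0); apply: le_trans.
  have Q0 : 0 < q%:R :> R by rewrite ltr0n.
  have Q'0 : 0 < q'%:R :> R by rewrite ltr0n.
  have hK (r : nat) : r%:R ^+ 2 * (l / (8 * M)) <= K -> 2 * l * r%:R ^+ 2 <= 1.
    rewrite -(ler_pM2r M16) KM.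
    have -> : r%:R ^+ 2 * (l / (8 * M)) * (16 * M) = 2 * l * r%:R ^+ 2.
      by field; rewrite gt_eqF.
    by [].
  have [{}qK {}q'K] := (hK q qK, hK q' q'K).
  rewrite -[leRHS]mul1r ler_pdivlMr ?mulr_gt0//.
  have : q%:R * q'%:R <= (q%:R ^+ 2 + q'%:R ^+ 2) / 2 :> R.
    by have := sqr_ge0 (q%:R - q'%:R : R); rewrite !expr2; lra.
  rewrite -(ler_pM2l (mulr_gt0 (ltr0n _ 2) l0)) => /le_trans; apply.
  by lra.
have [[p1 [q1 [q10 q1K q1a]]]|none] := pselect (exists p : int, exists q : nat,
  [/\ (0 < q)%N, q%:R ^+ 2 * (l / (8 * M)) <= K &
      a - l / 4 <= p%:~R / q%:R <= a + l / 2]).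
- exists (a + 3 / 4 * l); split; [lra|lra|].
  move=> x p q xb q0 qK Kq; apply: le_trans (cq q Kq) _.
  have [pq|pq] := eqVneq (p%:~R / q%:R : R) (p1%:~R / q1%:R).
    by rewrite pq ger0_norm; lra.
  have := sep p p1 q q1 q0 q10 qK q1K pq.
  by rewrite !ler_normr => /orP[] pp; apply/orP; [right|left]; lra.
- exists a; split; [lra|lra|].
  move=> x p q xb q0 qK Kq; apply: le_trans (cq q Kq) _.
  rewrite leNgt; apply/negP => near_x; apply: none; exists p, q; split => //.
  by move: near_x; rewrite ltr_norml; lra.
Qed.

(** The children fill the quarter of [good_quarter], with gaps of their own length. A denominator
    visible to them is either visible already at the scale [l] or kept away by that quarter. *)
Lemma good_children a l h : 0 < l -> good a l h ->
  exists ch : nat -> R, (forall d, (d < m)%N ->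
    [/\ a <= ch d, ch d + l / (8 * M) <= a + l &
      good (ch d) (l / (8 * M)) h]) /\
    (forall d d', (d < d')%N -> ch d + 2 * (l / (8 * M)) <= ch d').
Proof.
have [hM1 hM0 hK0] := And3 M1 M0 K0.
move=> l0 gl; have [b [ab ba bP]] := good_quarter l0 gl.
set l' := l / (8 * M).
have l'0 : 0 < l' by rewrite divr_gt0// mulr_gt0.
have l'E : 8 * M * l' = l by rewrite /l' mulrC divfK// gt_eqF ?mulr_gt0.
exists (fun d => b + 2 * d%:R * l'); split=> [d dm|d d' dd']; last first.
  have : d%:R + 1 <= d'%:R :> R by rewrite natr1 ler_nat.
  by rewrite -(ler_pM2r l'0); lra.
have d0 : 0 <= 2 * d%:R * l' by apply: mulr_ge0; [exact: mulr_ge0|exact: ltW].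
have dl : 2 * d%:R * l' + l' <= l / 4.
  have : d%:R + 1 <= M :> R by rewrite natr1 ler_nat.
  rewrite -(ler_pM2r l'0); lra.
split; [lra|lra|].
move=> x p q xb q0 qK.
have [Kq|Kq] := lerP (q%:R ^+ 2 * l) K.
  by apply: gl => //; apply/andP; split; lra.
have bx : b <= x <= b + l / 4 by apply/andP; split; lra.
have cx := bP x p q bx q0 qK Kq; split=> // _.
by apply: le_trans cx; apply: phi_le; rewrite ler1n.
Qed.

Hypothesis phi_gt0 : forall t : R, 1 <= t -> 0 < phi t.
Hypothesis phi_noninc : forall t u : R, 1 <= t -> t <= u -> phi u <= phi t.
Hypothesis phi_mul : forall t u : R, 1 <= t -> t <= u -> u * phi u <= t * phi t.

(** Dirichlet's theorem at the centre, with bound [X], gives an error e with q X e < 2. A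
    denominator up to [h] contradicts [phi q <= e], as [t * phi t] decreases. One between [h] and
    [H] must be at least H / 8, so its fraction lies in the interval, where goodness fails at the
    fraction itself. *)
Lemma good_approximation a l h H X : 0 < l -> good a l h ->
    H ^+ 2 * l = K -> 0 < H -> X * (4 * c) = H -> 1 <= X -> 1 <= h ->
    2 < h * phi h * X ->
  exists p : int, exists q : nat, [/\ (0 < q)%N, coprime `|p| q,
    H < q%:R, q%:R <= X & `|a + l / 2 - p%:~R / q%:R| <= l / 8].
Proof.
have [[hM1 hM0 hK0] hc0] := (And3 M1 M0 K0, c0).
move=> l0 gl HK H0 XH X1 h1 hX.
have X0 : 0 < X by lra.
have Q0 : (0 < Num.truncn X)%N by rewrite truncn_gt0.
have /andP[QX XQ] := truncn_itv (ltW X0).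
have [p [q [/andP[q0 qQ] pq apq]]] := dirichlet (a + l / 2) Q0.
have q0' : 0 < q%:R :> R by rewrite ltr0n.
have q1 : 1 <= q%:R :> R by rewrite ler1n.
have qX : q%:R <= X by apply: le_trans QX; rewrite ler_nat.
set x := a + l / 2 in apq *.
set e := `|x - p%:~R / q%:R|.
have eE : q%:R * e = `|q%:R * x - p%:~R|.
  rewrite /e -{1}(gtr0_norm q0') -normrM mulrBr; congr `|_ - _|.
  by field; rewrite gt_eqF.
have {apq} eX : q%:R * X * e < 2.
  rewrite mulrAC eE.
  have Q1 : 1 <= (Num.truncn X)%:R :> R by rewrite ler1n.
  have : `|q%:R * x - p%:~R| * (Num.truncn X)%:R < 1.
    by rewrite -ltr_pdivlMr ?div1r// ltr0n.
  have : 0 <= `|q%:R * x - p%:~R| by [].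
  move: XQ; rewrite -natr1; set T := _%:R; set d := `|_| => XT d0 dT.
  have : d * X <= d * (2 * T) by apply: ler_wpM2l => //; lra.
  by lra.
have e0 : 0 <= e by rewrite normr_ge0.
have xJ : a <= x <= a + l by apply/andP; rewrite /x; split; lra.
have Hl : H * (H * l) = K by rewrite mulrA -expr2.
have Hl0 : 0 < H * l by rewrite mulr_gt0.
have e_small : H / 8 <= q%:R -> e <= l / 8.
  move=> Hq; have : H / 8 * X * e <= q%:R * X * e.
    by apply: ler_wpM2r => //; apply: ler_wpM2r => //; exact: ltW.
  have : H * X * (4 * c) = H * H by rewrite -mulrA XH.
  move=> HX h2; have h3 : H * X * e < 16 by lra.
  have : H * X * e * (4 * c) < 16 * (4 * c) by rewrite ltr_pM2r// mulr_gt0.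
  have -> : H * X * e * (4 * c) = H * H * e by rewrite -HX; ring.
  have -> : 16 * (4 * c) = H * H * (l / 8).
    have -> : H * H * (l / 8) = H * (H * l) / 8 by ring.
    by rewrite Hl KE; field.
  by rewrite ltr_pM2l ?mulr_gt0// => /ltW.
have [qK|qK] := lerP (q%:R ^+ 2 * l) K; last first.
  have Hq : H < q%:R.
    by rewrite -(ltr_pXn2r (n := 2)) ?nnegrE ?(ltW H0)// -(ltr_pM2r l0) HK.
  by exists p, q; split => //; apply: e_small; lra.
exfalso; have [gh ge] := gl x p q xJ q0 qK.
have [qh|hq] := lerP q%:R h.
  have := gh qh; rewrite -/e => phie.
  have := phi_mul q1 qh => /(ler_wpM2r (ltW X0)) h2.
  have : q%:R * phi q%:R * X <= q%:R * X * e.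
    by rewrite mulrAC ler_pM2l// mulr_gt0.
  by lra.
have q2 : 0 < q%:R ^+ 2 :> R by rewrite exprn_gt0.
have Hq : H / 8 <= q%:R.
  have := ge hq; rewrite -/e ler_pdivrMr// => h2.
  have h3 : X * c <= 2 * q%:R.
    rewrite -(ler_pM2l q0').
    apply: (@le_trans _ _ (q%:R * X * (e * q%:R ^+ 2))).
      by rewrite -mulrA ler_pM2l// ler_pM2l.
    have -> : q%:R * X * (e * q%:R ^+ 2) = q%:R * X * e * q%:R * q%:R by ring.
    have -> : q%:R * (2 * q%:R) = 2 * q%:R * q%:R :> R by ring.
    by rewrite !ler_pM2r// ltW.
  by lra.
have fJ : a <= p%:~R / q%:R <= a + l.
  have := e_small Hq; rewrite /e /x ler_norml => /andP[? ?].
  by apply/andP; split; lra.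
have [_ gf] := gl _ p q fJ q0 qK.
by have := gf hq; rewrite subrr normr0 leNgt divr_gt0.
Qed.

(* By goodness the fraction found by Dirichlet's theorem at the centre has a
   new denominator, comparable to [H]; an interval close to it stays away from
   all other fractions with denominators up to [h']. *)
Lemma good_special a l h H X h' : 0 < l -> good a l h ->
    H ^+ 2 * l = K -> 1 <= H -> X * (4 * c) = H -> 1 <= X -> 1 <= h ->
    2 < h * phi h * X -> phi H <= l / 8 -> 16 * K * phi H * X ^+ 2 <= 1 ->
    0 <= h' -> h' ^+ 2 * phi H = K ->
  exists p : int, exists q : nat, let f := p%:~R / q%:R in
    [/\ (0 < q)%N, coprime `|p| q, H < q%:R <= X,
     a <= f + phi H /\ f + 2 * phi H <= a + l & good (f + phi H) (phi H) h'].
Proof.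
have [[hM1 hM0 hK0] hc0] := (And3 M1 M0 K0, c0).
move=> l0 gl HK H1 XH X1 h1 hX rl rX h'0 h'K.
have H0 : 0 < H by lra.
have [p [q [q0 pq Hq qX xf]]] := good_approximation l0 gl HK H0 XH X1 h1 hX.
set r := phi H in rl rX h'K *; have r0 : 0 < r by exact: phi_gt0.
exists p, q => f; rewrite -/f in xf.
have fx : a + 3 / 8 * l <= f <= a + 5 / 8 * l.
  by move: xf; rewrite ler_norml => /andP[? ?]; apply/andP; split; lra.
have Q0 : 0 < q%:R :> R by rewrite ltr0n.
split=> //; [by rewrite Hq|by split; lra|].
move=> x p' q' xJ q'0 q'K; have Q'0 : 0 < q'%:R :> R by rewrite ltr0n.
have q'1 : 1 <= q'%:R :> R by rewrite ler1n.
(* Every denominator visible at the scale [r] is at most [h'], so only the bound by [phi] is at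
   stake. *)
have q'h : q'%:R <= h'.
  by rewrite -(ler_pXn2r (n := 2)) ?nnegrE// -(ler_pM2r r0) h'K.
split; last by rewrite ltNge q'h.
move=> _; have xJ' : a <= x <= a + l by apply/andP; split; lra.
have [q'l|q'l] := lerP (q'%:R ^+ 2 * l) K.
  have [g1 g2] := gl x p' q' xJ' q'0 q'l.
  have [/g1//|/g2] := lerP q'%:R h.
  by apply: le_trans; exact: phi_le.
have Hq' : H < q'%:R.
  by rewrite -(ltr_pXn2r (n := 2)) ?nnegrE ?(ltW H0)// -(ltr_pM2r l0) HK.
have [ff|ff] := eqVneq (p'%:~R / q'%:R) f.
  rewrite ff ger0_norm; last lra.
  by apply: le_trans (phi_noninc H1 (ltW Hq')) _; rewrite -/r; lra.
have := fraction_separation q'0 q0 ff; rewrite -/f.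
set d := _^-1 => dle.
have q'q0 : 0 < q'%:R * q%:R :> R by rewrite mulr_gt0.
(* As [x] is within [2 * r] of [f], at least half of the separation [d] remains, and that suffices
   by [dq']. *)
have rd : 4 * r <= d.
  rewrite /d -[leRHS]mul1r ler_pdivlMr//.
  have r4 : 0 <= 4 * r * (q'%:R * q%:R).
    by apply: mulr_ge0; [apply: mulr_ge0 => //; exact: ltW|exact: ltW].
  rewrite -(ler_pXn2r (n := 2)) ?nnegrE// expr1n; apply: le_trans rX.
  have -> : (4 * r * (q'%:R * q%:R)) ^+ 2 =
    16 * (q'%:R ^+ 2 * r) * r * q%:R ^+ 2 by ring.
  apply: ler_pM; rewrite ?exprn_ge0 ?mulr_ge0 ?exprn_ge0 ?(ltW r0)//.
    by rewrite ler_pM2r// ler_pM2l.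
  by rewrite ler_sqr ?nnegrE; lra.
have dq' : 2 * c / q'%:R ^+ 2 <= d.
  rewrite /d ler_pdivrMr ?exprn_gt0// expr2 invfM.
  have -> : q'%:R^-1 / q%:R * (q'%:R * q'%:R) = q'%:R / q%:R :> R.
    by field; rewrite !gt_eqF.
  rewrite ler_pdivlMr//; apply: (@le_trans _ _ (2 * c * X)).
    by rewrite ler_pM2l// mulr_gt0.
  by lra.
apply: (le_trans (phi_le q'1)).
have : d - 2 * r <= `|x - p'%:~R / q'%:R|.
  have : `|p'%:~R / q'%:R - f| <= `|x - p'%:~R / q'%:R| + 2 * r.
    rewrite (_ : _ - f = (x - f) - (x - p'%:~R / q'%:R)); last by ring.
    apply: le_trans (ler_normB _ _) _; rewrite addrC lerD2l.
    by rewrite ger0_norm; lra.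
  by lra.
have : c / q'%:R ^+ 2 = 2 * c / q'%:R ^+ 2 / 2 by field; rewrite gt_eqF.
by lra.
Qed.

End good_intervals.

(** * Nested intervals and their limit points *)

Section tree.
Variables (R : realType) (phi : R -> R) (K c : R) (m : nat) (s : R).
Let M : R := m%:R.
(** The largest denominator visible at the scale [l]; [width] is the bound [X] given to Dirichlet's
    theorem. *)
Let height (l : R) := Num.sqrt (K / l).
Let width (H : R) := H / (4 * c).

(** The conditions of [good_special], followed by the one that preserves [len_mass]. *)
Let jump (k : nat) (l h : R) := let H := height l in
  [/\ 1 <= H, 1 <= width H, 2 < h * phi h * width H, phi H <= l / 8 &
    16 * K * phi H * width H ^+ 2 <= 1 /\ (1 / 8) `^ s <= M ^+ k * phi H `^ s].

(* Length of the intervals of level [k] and bound [h] for which they are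
   [good]. We jump next to a fraction as soon as
   this keeps [M ^+ k * len k `^ s] bounded below. *)
Fixpoint scale (k : nat) : R * R :=
  if k is k'.+1 then
    let: (l, h) := scale k' in
    if `[< jump k' l h >]
    then (phi (height l) / (8 * M), Num.sqrt (K / phi (height l)))
    else (l / (8 * M), h)
  else (1 / 8, 1).

Let len k := (scale k).1.
Let bnd k := (scale k).2.
Let jumps k := jump k (len k) (bnd k).

Hypothesis m0 : (0 < m)%N.
Hypotheses (KM : K * (16 * M) = 1) (KE : K = 512 * c).
Hypothesis phi_le : forall t : R, 1 <= t -> phi t <= c / t ^+ 2.
Hypothesis phi_gt0 : forall t : R, 1 <= t -> 0 < phi t.
Hypothesis phi_noninc : forall t u : R, 1 <= t -> t <= u -> phi u <= phi t.
Hypothesis phi_mul : forall t u : R, 1 <= t -> t <= u -> u * phi u <= t * phi t.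

Let M1 : 1 <= M. Proof. by rewrite ler1n. Qed.
Let M0 : 0 < M. Proof. exact: lt_le_trans M1. Qed.
Let M80 : 0 < 8 * M. Proof. by rewrite mulr_gt0. Qed.
Let M16 : 0 < 16 * M. Proof. exact: mulr_gt0. Qed.
Let K0 : 0 < K. Proof. by rewrite -(pmulr_lgt0 _ M16) KM. Qed.
Let c0 : 0 < c. Proof. by have := K0; rewrite KE; lra. Qed.

Let lenS_jump k : jumps k -> len k.+1 = phi (height (len k)) / (8 * M) /\
  bnd k.+1 = Num.sqrt (K / phi (height (len k))).
Proof.
rewrite /jumps /len /bnd /=; case: (scale k) => l h /= jk.
by rewrite ifT//; apply/asboolP.
Qed.

Let lenS_nojump k : ~ jumps k -> len k.+1 = len k / (8 * M) /\ bnd k.+1 = bnd k.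
Proof.
rewrite /jumps /len /bnd /=; case: (scale k) => l h /= jk.
by rewrite ifF//; apply/asboolPn.
Qed.

Let len_gt0 k : 0 < len k.
Proof.
elim: k => [|k IHk]; first by rewrite /len /=; lra.
have [j|j] := pselect (jumps k).
  by rewrite (lenS_jump j).1; apply: divr_gt0 M80; apply: phi_gt0; case: j.
by rewrite (lenS_nojump j).1; exact: divr_gt0 IHk M80.
Qed.

Let heightK k : height (len k) ^+ 2 * len k = K.
Proof. by rewrite sqr_sqrtr ?divfK ?gt_eqF// divr_ge0// ltW. Qed.

Let bnd_ge1 k : 1 <= bnd k.
Proof.
elim: k => [|k IHk]; first by rewrite /bnd.
have [j|j] := pselect (jumps k); last by rewrite (lenS_nojump j).2.
rewrite (lenS_jump j).2; case: j => H1 _ _ Hl _.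
have r0 := phi_gt0 H1; have l0 := len_gt0 k.
apply: le_trans H1 _; apply: ler_wsqrtr.
by rewrite ler_pM2l// lef_pV2 ?posrE//; lra.
Qed.

Let lenS_le k : 8 * len k.+1 <= len k.
Proof.
have [hM1 hM80] := (M1, M80); have l0 := len_gt0 k.
have le8 x y : 0 < x -> x <= y -> 8 * (x / (8 * M)) <= y.
  move=> x0; apply: le_trans; rewrite mulrA ler_pdivrMr// mulrC.
  by rewrite ler_pM2l//; lra.
have [j|j] := pselect (jumps k).
  rewrite (lenS_jump j).1; case: j => H1 _ _ Hl _.
  by apply: le8; [exact: phi_gt0|lra].
by rewrite (lenS_nojump j).1; apply: le8.
Qed.

Let len_le k : k.+1%:R * len k <= 1.
Proof.
elim: k => [|k IHk]; first by rewrite /len /=; lra.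
have := lenS_le k; have := len_gt0 k.+1; move: IHk.
rewrite -[k.+2%:R]natr1 -natr1.
have : 0 <= k%:R :> R by []. move: (k%:R : R) (len k) (len k.+1) => n x y.
by move=> *; nra.
Qed.

Let node k (a : R) := good phi K c a (len k) (bnd k).

Let children k (a : R) (ch : nat -> R) :=
  [/\ forall d, (d < m)%N ->
        [/\ a <= ch d, ch d + len k.+1 <= a + len k & node k.+1 (ch d)],
    forall d d', (d < d')%N -> ch d + 2 * len k.+1 <= ch d' &
    jumps k -> exists p : int, exists q : nat, let f := p%:~R / q%:R in
      let H := height (len k) in
      [/\ (0 < q)%N, coprime `|p| q, H < q%:R <= width H &
        forall d, (d < m)%N ->
          f + phi H <= ch d /\ ch d + len k.+1 <= f + 2 * phi H]].

Let children_exist k a : node k a -> exists ch, children k a ch.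
Proof.
move=> ga; have l0 := len_gt0 k.
have [j|j] := pselect (jumps k); last first.
  have [ch [ch1 ch2]] := good_children m0 KM KE phi_le l0 ga.
  have [lE bE] := lenS_nojump j.
  by exists ch; split => //; rewrite /node lE ?bE.
have [lE bE] := lenS_jump j; case: (j) => H1 X1 hX Hl [HX _].
have [hc0 hK0] := (c0, K0).
have r0 := phi_gt0 H1.
have XH : width (height (len k)) * (4 * c) = height (len k).
  by rewrite /width divfK// gt_eqF// mulr_gt0.
have bE2 : bnd k.+1 ^+ 2 * phi (height (len k)) = K.
  by rewrite bE sqr_sqrtr ?divfK ?gt_eqF// divr_ge0// ltW.
have b0 : 0 <= bnd k.+1 by apply: le_trans (bnd_ge1 k.+1).
have [p [q [q0 pq Hq [af fa] gf]]] :=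
  good_special m0 KM KE phi_le phi_gt0 phi_noninc
  phi_mul l0 ga (heightK k) H1 XH X1 (bnd_ge1 k) hX Hl HX b0 bE2.
have [ch [ch1 ch2]] := good_children m0 KM KE phi_le r0 gf.
exists ch; split; rewrite /node lE => //.
- by move=> d dm; have [h1 h2 h3] := ch1 d dm; split => //; lra.
- move=> _; exists p, q; split => // d dm; have [h1 h2 h3] := ch1 d dm.
  by split => //; lra.
Qed.

Let child_exists : exists ch : nat -> R -> nat -> R,
  forall k a, node k a -> children k a (ch k a).
Proof.
suff /boolp.choice[ch chP] : forall ka : nat * R, exists ch : nat -> R,
    node ka.1 ka.2 -> children ka.1 ka.2 ch.
  by exists (fun k a => ch (k, a)) => k a; exact: (chP (k, a)).
move=> [k a] /=; have [ga|ga] := pselect (node k a); last by exists (fun=> 0).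
by have [ch chP] := children_exist ga; exists ch.
Qed.

Let idx k (x : R) := Num.truncn (x * M ^+ k).

Let idxS k (x : R) : 0 <= x -> (idx k.+1 x %/ m)%N = idx k x.
Proof.
move=> x0; apply/esym/truncn_def.
have xM j : 0 <= x * M ^+ j by rewrite mulr_ge0// exprn_ge0// ltW.
have /andP[] := truncn_itv (xM k.+1); rewrite -/(idx k.+1 x) exprSr mulrA.
set i := idx _ _; set y := x * _ => h1 h2.
have := divn_eq i m => iE; have im : (i %% m < m)%N by rewrite ltn_mod.
apply/andP; split.
  rewrite -(ler_pM2r M0); apply: le_trans h1.
  by rewrite -natrM ler_nat {2}iE leq_addr.
rewrite -(ltr_pM2r M0); apply: lt_le_trans h2 _.
by rewrite -natrM ler_nat {1}iE mulSn addnC ltn_add2r.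
Qed.

Let idx_dist k (x y : R) : 0 <= x -> 0 <= y -> idx k x = idx k y ->
  `|x - y| * M ^+ k <= 1.
Proof.
move=> x0 y0 xy.
have Mk : 0 <= M ^+ k by rewrite exprn_ge0// ltW.
have /andP[] := truncn_itv (mulr_ge0 x0 Mk).
have /andP[] := truncn_itv (mulr_ge0 y0 Mk).
rewrite -/(idx k x) -/(idx k y) xy -natr1 => h1 h2 h3 h4.
rewrite -[X in _ * X](ger0_norm Mk) -normrM mulrBl ler_norml.
by apply/andP; split; lra.
Qed.

(* [G] follows the base [m] digits of [x] down the tree. *)
Lemma tree_limit : exists G : R -> R,
  [/\ forall x : R, 0 <= x < 1 -> 1 / 4 <= G x <= 3 / 8,
    forall x : R, 0 <= x < 1 -> forall (p : int) (q : nat), (0 < q)%N ->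
      phi q%:R <= `|G x - p%:~R / q%:R|,
    forall x : R, 0 <= x < 1 -> forall k, jumps k ->
      exists p : int, exists q : nat, let f := p%:~R / q%:R in
        let H := height (len k) in
        [/\ (0 < q)%N, coprime `|p| q, H < q%:R <= width H &
          f + phi H <= G x <= f + 2 * phi H] &
    forall x y : R, 0 <= x < 1 -> 0 <= y < 1 -> x != y -> (1 < m)%N ->
      exists k, len k <= `|G x - G y| /\ `|x - y| * M ^+ k <= M].
Proof.
have [ch chP] := child_exists.
(* The base m digits of [i] are the address of an interval, the last digit selecting the child. *)
pose fix A (k i : nat) {struct k} : R := if k is k'.+1
  then ch k' (A k' (i %/ m)%N) (i %% m)%N else 1 / 4.
have [hM1 hM0] := (M1, M0).
have im i : (i %% m < m)%N by rewrite ltn_mod.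
have nodeA k i : node k (A k i).
  elim: k i => [|k IHk] i /=; last first.
    by have [h1 _ _] := chP k _ (IHk (i %/ m)%N); have [] := h1 _ (im i).
  move=> x p q _ q0; rewrite /len /= => h.
  have q1 : 1 <= q%:R ^+ 2 :> R by rewrite exprn_ege1// ler1n.
  (* The root is good vacuously: its length is 1 / 8, so no denominator is visible. *)
  have K16 : K <= 1 / 16.
    have -> : K = K * (16 * M) / (16 * M) by rewrite mulfK// gt_eqF.
    by rewrite KM div1r div1r lef_pV2 ?posrE//; lra.
  by exfalso; lra.
pose B x k := A k (idx k x).
have BS x k : 0 <= x -> B x k.+1 = ch k (B x k) (idx k.+1 x %% m)%N.
  by move=> x0; rewrite {1}/B /= idxS.
have Bch x k : 0 <= x -> children k (B x k) (ch k (B x k)).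
  by move=> x0; apply: chP; exact: nodeA.
have Bstep x k : 0 <= x -> B x k <= B x k.+1 /\
    B x k.+1 + len k.+1 <= B x k + len k.
  move=> x0; rewrite BS//; have [h _ _] := Bch x k x0.
  by have [] := h _ (im (idx k.+1 x)).
have Bmono x j k : 0 <= x -> (j <= k)%N -> B x j <= B x k /\
    B x k + len k <= B x j + len j.
  move=> x0 /subnK <-; elim: (k - j)%N => [//|n [h1 h2]].
  by rewrite addSn; have := Bstep x (n + j)%N x0; lra.
have Bub x j k : 0 <= x -> B x j <= B x k + len k.
  move=> x0; have [jk|/ltnW kj] := leqP j k.
    by have [h _] := Bmono x _ _ x0 jk; have := len_gt0 k; lra.
  by have [_ h] := Bmono x _ _ x0 kj; have := len_gt0 j; lra.
pose G x := sup (range (B x)).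
have BG x k : 0 <= x -> B x k <= G x <= B x k + len k.
  move=> x0; apply/andP; split.
    apply: ub_le_sup; last by exists k.
    by exists (B x 0%N + len 0) => _ [j _ <-]; exact: Bub.
  apply: ge_sup; first by exists (B x 0%N), 0%N.
  by move=> _ [j _ <-]; exact: Bub.
exists G; split.
- move=> x /andP[x0 _]; have := BG x 0%N x0.
  by rewrite /B /= /len /=; lra.
- move=> x /andP[x0 _] p q q0.
  (* A level deep enough for [q] to be visible, by [len_le]. *)
  pose k := Num.truncn (q%:R ^+ 2 / K).
  have qk : q%:R ^+ 2 * len k <= K.
    have : q%:R ^+ 2 / K < k.+1%:R by exact: truncnS_gt.
    rewrite ltr_pdivrMr// => /ltW h; have := len_le k.
    rewrite -(ler_pM2r K0) mul1r; apply: le_trans.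
    by rewrite [leRHS]mulrAC ler_pM2r.
  have [g1 g2] := nodeA k (idx k x) _ p q (BG x k x0) q0 qk.
  have [/g1//|/g2] := lerP q%:R (bnd k).
  by apply: le_trans; apply: phi_le; rewrite ler1n.
- move=> x /andP[x0 _] k jk; have [_ _ h] := Bch x k x0.
  have [p [q [q0 pq Hq dP]]] := h jk.
  exists p, q; split => //; have := dP _ (im (idx k.+1 x)).
  by rewrite -BS//; have := BG x k.+1 x0; lra.
- move=> x y /andP[x0 x1] /andP[y0 y1] xy mgt1.
  have : exists k, idx k x != idx k y.
    apply/not_existsP => same.
    have xy0 : 0 < `|x - y| by rewrite normr_gt0 subr_eq0.
    pose k := Num.truncn `|x - y|^-1.
    have : idx k.+1 x = idx k.+1 y.
      by apply/eqP; have /negP := same k.+1; rewrite negbK.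
    move/(idx_dist x0 y0); rewrite leNgt => /negP; apply.
    rewrite mulrC -ltr_pdivrMr// div1r; apply: (lt_le_trans (truncnS_gt _)).
    by rewrite -natrX ler_nat ltnW// ltn_expl.
  (* At the first level where the addresses differ the intervals are siblings, separated by a gap of
     their own length; agreement one level higher bounds the distance of [x] and [y]. *)
  move=> ex; pose k := ex_minn ex.
  have [kxy kmin] :
      idx k x != idx k y /\ forall j, (j < k)%N -> idx j x = idx j y.
    rewrite /k; case: ex_minnP => n nxy nmin; split => // j jn; apply/eqP.
    by apply: contraTT jn => /nmin; rewrite leqNgt.
  have idx0 z : 0 <= z -> z < 1 -> idx 0 z = 0%N.
    by move=> z0 z1; apply: truncn_def; rewrite expr0 mulr1 z0 z1.
  case: k kxy kmin => [|k] kxy kmin; first by rewrite !idx0// eqxx in kxy.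
  have kE := kmin k (ltnSn k).
  exists k.+1; split; last first.
    have := idx_dist x0 y0 kE; rewrite exprSr mulrA => h.
    by rewrite -[leRHS]mul1r ler_pM2r.
  have dxy : (idx k.+1 x %% m)%N != (idx k.+1 y %% m)%N.
    apply: contraNneq kxy => e; rewrite (divn_eq (idx k.+1 x) m).
    by rewrite (divn_eq (idx k.+1 y) m) !idxS// kE e.
  have [_ sep _] := Bch x k x0.
  have := BG x k.+1 x0; have := BG y k.+1 y0; rewrite !BS//.
  have BE : B y k = B x k by rewrite /B kE.
  rewrite BE; move: dxy; rewrite neq_ltn => /orP[] /sep h h1 h2.
  + by rewrite ler_normr; apply/orP; right; lra.
  + by rewrite ler_normr; apply/orP; left; lra.
Qed.

Variables (u c1 : R).
Hypotheses (s0 : 0 <= s) (c10 : 0 < c1).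
Hypothesis phi_lb : forall t : R, 1 <= t ->
  c1 * (t ^+ 2) `^ (- u) <= phi t `^ s.
Hypothesis phi_small : forall e : R, 0 < e -> exists T : R,
  forall t : R, 1 <= t -> T <= t -> t ^+ 2 * phi t <= e.
Hypothesis M_grow : 2 * (8 * M) `^ u <= M.
Hypothesis M_s : (8 * M) `^ s <= M.

(** A subdivision multiplies the right side by M / (8 M)^s, at least 1 by [M_s]; for a jump the last
    clause of [jump] gives the bound directly. *)
Let len_mass k : (1 / 8) `^ s <= M ^+ k * len k `^ s.
Proof.
elim: k => [|k IHk]; first by rewrite expr0 [leRHS]mul1r.
have step (x : R) : 0 <= x -> M ^+ k * x `^ s <= M ^+ k.+1 * (x / (8 * M)) `^ s.
  move=> x0; have Mk : 0 < M ^+ k by rewrite exprn_gt0.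
  rewrite exprSr -mulrA ler_pM2l// powRM ?invr_ge0 ?(ltW M80)// mulrCA.
  rewrite -[leLHS]mulr1 ler_wpM2l ?powR_ge0//.
  rewrite -powR_inv1 ?(ltW M80)// -powRrM mulN1r powRN ler_pdivlMr ?powR_gt0//.
  by rewrite mul1r.
have [j|j] := pselect (jumps k); last first.
  by rewrite (lenS_nojump j).1; apply: le_trans IHk _; exact: step (ltW _).
rewrite (lenS_jump j).1; case: j => H1 _ _ _ [_ j].
by apply: le_trans j _; apply: step; apply: ltW; exact: phi_gt0.
Qed.

Let pow2_large (z : R) : exists n : nat, forall n', (n <= n')%N -> z <= 2 ^+ n'.
Proof.
exists (Num.truncn z).+1 => n' nn'; apply: (le_trans (ltW (truncnS_gt z))).
by rewrite -natrX ler_nat (leq_trans nn')// ltnW// ltn_expl.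
Qed.

(** Without jumps [bnd] is constant and the heights grow geometrically, so [phi_small] yields the
    size conditions. By [phi_lb] and [M_grow], M^n phi(H)^s grows at least like 2^n, which yields
    the last one. *)
Let jumps_often k0 : exists2 k, (k0 <= k)%N & jumps k.
Proof.
apply: contrapT => nojump.
have nj n : ~ jumps (k0 + n)%N.
  by move=> j; apply: nojump; exists (k0 + n)%N => //; exact: leq_addr.
have [[hM1 hM80] [hK0 hc0]] := ((M1, M80), (K0, c0)).
have bE n : bnd (k0 + n) = bnd k0.
  by elim: n => [|n IHn]; rewrite ?addn0// addnS (lenS_nojump (nj n)).2.
have lE n : len (k0 + n) * (8 * M) ^+ n = len k0.
  elim: n => [|n IHn]; first by rewrite addn0 expr0 mulr1.
  rewrite addnS (lenS_nojump (nj n)).1 exprS mulrA divfK ?gt_eqF//.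
have l0 := len_gt0 k0.
pose Z := K / len k0; have Z0 : 0 < Z by rewrite divr_gt0.
have HE n : height (len (k0 + n)) ^+ 2 = Z * (8 * M) ^+ n.
  have ln0 := len_gt0 (k0 + n)%N.
  apply: (mulIf (lt0r_neq0 ln0)); rewrite heightK mulrAC -mulrA lE /Z.
  by rewrite divfK// gt_eqF.
pose h := bnd k0; have h1 : 1 <= h := bnd_ge1 k0.
have hp : 0 < h * phi h by rewrite mulr_gt0 ?phi_gt0// (lt_le_trans ltr01).
have [T TP] : exists T : R, forall t : R, 1 <= t -> T <= t ->
    t ^+ 2 * phi t <= Num.min (K / 8) (c ^+ 2 / K).
  by apply: phi_small; rewrite lt_min !divr_gt0// exprn_gt0.
(* [T1] collects the lower bounds on [H] for all clauses of [jump] but the last; [n1] ensures them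
   and [n2] the last. *)
pose T1 := Num.max (Num.max T 1) (Num.max (4 * c) (8 * c / (h * phi h) + 1)).
have [n1 n1P] := pow2_large (T1 ^+ 2 / Z).
have [n2 n2P] := pow2_large ((1 / 8) `^ s / (c1 * Z `^ (- u))).
pose n := maxn n1 n2; apply: (nj n).
set k := (k0 + n)%N; pose H := height (len k).
have M8n : 0 < (8 * M) ^+ n by rewrite exprn_gt0.
have T1H : T1 <= H.
  rewrite -(ler_pXn2r (n := 2)) ?nnegrE ?sqrtr_ge0//; last first.
    by rewrite !le_max ler01 orbT.
  rewrite HE mulrC -ler_pdivrMr//; apply: le_trans (n1P n (leq_maxl _ _)) _.
  by apply: lerXn2r; rewrite ?nnegrE//; lra.
move: T1H; rewrite !ge_max => /andP[/andP[TH H1] /andP[cH hH]].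
have H0 : 0 < H by lra.
have := TP H H1 TH; rewrite le_min => /andP[HK Hc].
have X0 : 0 < width H by rewrite /width divr_gt0// mulr_gt0.
have XE : width H * (4 * c) = H by rewrite /width divfK// gt_eqF// mulr_gt0.
rewrite /jumps /jump -/H bE -/h; split=> //.
- by rewrite /width ler_pdivlMr ?mul1r; [exact: cH|exact: mulr_gt0].
- rewrite /width mulrA ltr_pdivlMr ?mulr_gt0// [ltRHS]mulrC -ltr_pdivrMr//.
  by apply: lt_le_trans hH; rewrite mulrA -natrM ltrDl.
- have := heightK k; rewrite -/H => lK.
  by rewrite -(ler_pM2l (exprn_gt0 2 H0)) mulrA lK.
- split.
    rewrite /width exprMn exprVn.
    have -> : 16 * K * phi H * (H ^+ 2 / (4 * c) ^+ 2) =
      H ^+ 2 * phi H / (c ^+ 2 / K) by field; rewrite !gt_eqF.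
    by rewrite ler_pdivrMr ?mul1r// divr_gt0// exprn_gt0.
  have Zu : 0 < c1 * Z `^ (- u) by rewrite mulr_gt0// powR_gt0.
  have := phi_lb H1; rewrite HE powRM ?(ltW Z0) ?(ltW M8n)// mulrA => lb.
  apply: (@le_trans _ _ (M ^+ n * (c1 * Z `^ (- u) * ((8 * M) ^+ n) `^ (- u)))).
    have := n2P n (leq_maxr _ _); rewrite ler_pdivrMr// => /le_trans; apply.
    rewrite [leRHS]mulrCA [leLHS]mulrC ler_pM2l//.
    have -> : ((8 * M) ^+ n) `^ (- u) = (((8 * M) `^ u) ^+ n)^-1.
      rewrite powRN -(powR_mulrn n (ltW M80)).
      by rewrite -(powR_mulrn n (powR_ge0 (8 * M) u)) powRAC.
    rewrite ler_pdivlMr ?exprn_gt0 ?powR_gt0// -exprMn.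
    by apply: lerXn2r; rewrite ?nnegrE ?mulr_ge0 ?powR_ge0// ltW.
  apply: ler_pM => //; first by rewrite exprn_ge0// ltW.
    by rewrite mulr_ge0 ?powR_ge0// ltW.
  by rewrite /k exprD ler_peMl ?exprn_ege1// exprn_ge0// ltW.
Qed.

(** For the Hoelder bound: at the level where the addresses split, the distance of [x] and [y] is at
    most M / M^k, and the s-th power of the distance of their images is at least that of [len k], to
    which [len_mass] applies. *)
Lemma tree_family : (1 < m)%N -> exists G : R -> R, exists C : R,
  [/\ 0 < C, forall x : R, 0 <= x < 1 -> 1 / 4 <= G x <= 3 / 8,
    forall x : R, 0 <= x < 1 -> forall (p : int) (q : nat), (0 < q)%N ->
      phi q%:R <= `|G x - p%:~R / q%:R|,
    forall x : R, 0 <= x < 1 -> forall B : R,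
      exists p : int, exists q : nat, exists H : R, let f := p%:~R / q%:R in
      [/\ (0 < q)%N, coprime `|p| q, 1 <= H /\ B <= H, H < q%:R <= H / (4 * c) &
          f + phi H <= G x <= f + 2 * phi H] &
    forall x y : R, 0 <= x < 1 -> 0 <= y < 1 ->
      `|x - y| <= C * `|G x - G y| `^ s].
Proof.
move=> m1; have [G [G1 G2 G3 G4]] := tree_limit.
have a8 : 0 < (1 / 8) `^ s :> R by rewrite powR_gt0.
exists G, (M / (1 / 8) `^ s); split => //; first by rewrite divr_gt0.
- move=> x x01 B; have [k Bk jk] := jumps_often (Num.truncn (B ^+ 2 / K)).
  have [p [q [q0 pq Hq fq]]] := G3 x x01 k jk.
  exists p, q, (height (len k)); split => //; split; first by case: jk.
  apply: le_trans (ler_norm B) _.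
  rewrite -(ler_pXn2r (n := 2)) ?nnegrE ?sqrtr_ge0// real_normK ?num_real//.
  rewrite -(ler_pM2r (len_gt0 k)) heightK.
  have : B ^+ 2 / K < k.+1%:R.
    by apply: (lt_le_trans (truncnS_gt _)); rewrite ler_nat.
  rewrite ltr_pdivrMr// => /ltW h.
  have := ler_wpM2r (ltW K0) (len_le k); rewrite mul1r; apply: le_trans.
  by rewrite [leRHS]mulrAC ler_pM2r.
- move=> x y x01 y01; have [->|xy] := eqVneq x y.
    by rewrite subrr normr0 mulr_ge0 ?powR_ge0// divr_ge0// ltW.
  have [k [kG kM]] := G4 x y x01 y01 xy m1.
  have Mk : 0 < M ^+ k by rewrite exprn_gt0.
  rewrite -(ler_pM2r Mk); apply: (le_trans kM).
  rewrite -!mulrA ler_peMr ?(ltW M0)//.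
  have -> : ((1 / 8) `^ s)^-1 * (`|G x - G y| `^ s * M ^+ k) =
    M ^+ k * `|G x - G y| `^ s / (1 / 8) `^ s by ring.
  rewrite ler_pdivlMr// [leLHS]mul1r; apply: le_trans (len_mass k) _.
  rewrite ler_pM2l//; apply: ge0_ler_powR; rewrite ?nnegrE//.
  exact: ltW.
Qed.

End tree.

(** * Growth exponents *)

Section limsup_exponent.
Variable R : realType.

Lemma limn_esup_le (u : (\bar R)^nat) (l : R) :
    (forall e : R, 0 < e -> exists n : nat, forall k : nat, (n <= k)%N ->
      (u k <= (l + e)%:E)%E) ->
  (limn_esup u <= l%:E)%E.
Proof.
move=> h; apply/lee_addgt0Pr => e e0; have [n nP] := h e e0.
rewrite limn_esup_lim; apply: lime_le; first exact: is_cvg_esups.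
exists n => // k /= nk; apply: ge_ereal_sup => _ [j /= kj <-].
by rewrite -EFinD; apply: nP; exact: leq_trans kj.
Qed.

Lemma limn_esup_ge (u : (\bar R)^nat) (l : R) :
    (forall e : R, 0 < e -> forall n : nat, exists2 k : nat, (n <= k)%N &
      ((l - e)%:E <= u k)%E) ->
  (l%:E <= limn_esup u)%E.
Proof.
move=> h; apply/lee_subgt0Pr => e e0.
rewrite limn_esup_lim; apply: lime_ge; first exact: is_cvg_esups.
apply: nearW => n; have [k nk uk] := h e e0 n.
by apply: le_trans uk _; apply: ereal_sup_ubound; exists k.
Qed.

Lemma ln_nat_large (B : R) :
  exists n : nat, forall k : nat, (n <= k)%N -> (1 < k)%N /\ B <= ln k%:R :> R.
Proof.
exists (Num.truncn (expR B)).+2 => k nk; split; first by apply: leq_trans nk.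
have Bk : expR B <= k%:R.
  apply: (le_trans (ltW (truncnS_gt _))).
  by rewrite ler_nat (leq_trans _ nk).
have k0 : 0 < k%:R :> R by apply: lt_le_trans (expR_gt0 _) Bk.
by rewrite -ler_expR lnK.
Qed.

Lemma upper_Gamma_le (a b g C : R) : 0 <= g -> 0 < C ->
    (forall N : nat, (0 < N)%N -> diam_edit a b N <= C * N%:R `^ g) ->
  (upper_Gamma a b <= g%:E)%E.
Proof.
move=> g0 C0 h; apply: limn_esup_le => e e0.
(* From here on [e * ln N] absorbs the constant; the added 1 makes [ln N] positive. *)
have [n nP] := ln_nat_large (`|ln C| / e + 1).
exists n => N /nP[N1 lnN]; rewrite lee_fin.
have lnC0 : 0 <= `|ln C| / e by rewrite divr_ge0// ltW.
have lnN0 : 0 < ln N%:R :> R by lra.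
have N0 : 0 < N%:R :> R by rewrite ltr0n ltnW.
rewrite ler_pdivrMr//; have [D0|D0] := lerP (diam_edit a b N) 0.
  (* [ln] has the value 0 at nonpositive arguments. *)
  by rewrite ln0// mulr_ge0 ?addr_ge0// ltW.
have : ln (diam_edit a b N) <= ln C + g * ln N%:R.
  rewrite -ln_powR -lnM ?posrE ?powR_gt0//.
  by rewrite ler_ln ?posrE ?mulr_gt0 ?powR_gt0// h// ltnW.
have : ln C <= e * ln N%:R.
  apply: le_trans (ler_norm _) _; rewrite mulrC -ler_pdivrMr//.
  by lra.
by rewrite mulrDl; lra.
Qed.

Lemma upper_Gamma_ge (a b g C : R) : 0 < C ->
    (forall n : nat, exists2 N : nat, (n <= N)%N &
      C * N%:R `^ g <= diam_edit a b N) ->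
  (g%:E <= upper_Gamma a b)%E.
Proof.
move=> C0 h; apply: limn_esup_ge => e e0 n0.
have [n nP] := ln_nat_large (`|ln C| / e + 1).
have [N nN ND] := h (maxn n0 n); exists N.
  by apply: leq_trans nN; rewrite leq_maxl.
have [N1 lnN] := nP N (leq_trans (leq_maxr _ _) nN).
rewrite lee_fin.
have lnC0 : 0 <= `|ln C| / e by rewrite divr_ge0// ltW.
have lnN0 : 0 < ln N%:R :> R by lra.
have N0 : 0 < N%:R :> R by rewrite ltr0n ltnW.
rewrite ler_pdivlMr//.
have CN : 0 < C * N%:R `^ g by rewrite mulr_gt0 ?powR_gt0.
have : ln C + g * ln N%:R <= ln (diam_edit a b N).
  rewrite -ln_powR -lnM ?posrE ?powR_gt0// ler_ln ?posrE//.
  exact: lt_le_trans ND.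
have : - ln C <= e * ln N%:R.
  apply: le_trans (ler_norm _) _; rewrite normrN mulrC -ler_pdivrMr//.
  by lra.
by rewrite mulrBl; lra.
Qed.

End limsup_exponent.

(** * Multiples of almost every b stay away from the integers *)

Section almost_every.
Variable R : realType.
Local Notation mu := (@lebesgue_measure R).

Let near_int (q : nat) (b : R) : set R :=
  \big[setU/set0]_(k < q.+1) `[(k%:R - b) / q%:R, (k%:R + b) / q%:R]%classic.

Let measurable_near_int q b : measurable (near_int q b).
Proof. by apply: bigsetU_measurable => k _; exact: measurable_itv. Qed.

Let near_intP q b x : (0 < q)%N -> 0 < x < 1 ->
  (forall (k : int) (r : R),
    q%:R * x = k%:~R + r -> `|r| <= 1 / 2 -> `|r| < b) ->
  near_int q b x.
Proof.
move=> q0 /andP[x0 x1] h; have Q0 : 0 < q%:R :> R by rewrite ltr0n.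
pose k := Num.floor (q%:R * x + 1 / 2).
have /andP[] := real_floor_itv (num_real (q%:R * x + 1 / 2)).
rewrite -/k intrD => k1 k2.
have rk : `|q%:R * x - k%:~R| <= 1 / 2.
  by rewrite ler_norml; apply/andP; split; lra.
have := h k (q%:R * x - k%:~R) _ rk; rewrite addrC subrK => /(_ erefl) rb.
have k0 : 0 <= k.
  by rewrite /k real_floor_ge0 ?num_real// addr_ge0// mulr_ge0// ltW.
have [n kn] : exists n : nat, k = n%:Z by exists `|k|%N; rewrite gez0_abs.
have nq : (n < q.+1)%N.
  rewrite ltnS -ltnS -(ltr_nat R) -natr1; rewrite kn -pmulrn in k1.
  have : q%:R * x < q%:R by rewrite gtr_pMr.
  by lra.
rewrite /near_int -(bigcup_mkord q.+1 (fun k : nat =>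
  `[(k%:R - b) / q%:R, (k%:R + b) / q%:R]%classic)).
exists n => //=.
rewrite kn -pmulrn ltr_norml in rb.
rewrite in_itv/= ler_pdivrMr// ler_pdivlMr//.
by rewrite mulrC; apply/andP; split; lra.
Qed.

Let near_int_measure q b : (0 < q)%N -> 0 < b ->
  (mu (near_int q b) <= (4 * b)%:E)%E.
Proof.
move=> q0 b0; have Q0 : 0 < q%:R :> R by rewrite ltr0n.
have Q1 : 1 <= q%:R :> R by rewrite ler1n.
pose F (k : nat) : set R := `[(k%:R - b) / q%:R, (k%:R + b) / q%:R]%classic.
have mF k : (k < q.+1)%N -> measurable (F k) by move=> _; exact: measurable_itv.
have muF k : mu (F k) = (2 * b / q%:R)%:E.
  rewrite /F lebesgue_measure_itv/= lte_fin ltr_pM2r ?invr_gt0// ifT; last lra.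
  by rewrite -EFinB -mulrBl; congr (_ * _)%:E; lra.
apply: (le_trans (Boole_inequality mu mF)).
apply: (@le_trans _ _ (\sum_(k < q.+1) (2 * b / q%:R)%:E)%E).
  by apply: lee_sum => k _; rewrite -(muF k).
rewrite sumEFin lee_fin sumr_const card_ord -[_ *+ q.+1]mulr_natr [leLHS]mulrAC.
rewrite ler_pdivrMr//.
rewrite -[q.+1%:R]natr1.
have : b <= b * q%:R by rewrite ler_peMr// ltW.
by lra.
Qed.

(** An exceptional [x] lies in every [T i]: from some [J] on, all [q j * x] are within 1 / (i + 1)
    of an integer. [T i] is an increasing union of sets [S i J], each inside some [near_int], so its
    measure is at most 4 / (i + 1). *)
Lemma ae_far_from_int (q : nat -> nat) : (forall j, (0 < q j)%N) ->
  {ae mu, forall x : R, 0 < x < 1 -> exists2 b : R, 0 < b &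
    forall J : nat, exists j : nat, exists k : int, exists r : R,
      [/\ (J <= j)%N, (q j)%:R * x = k%:~R + r, `|r| <= 1 / 2 & b <= `|r|]}.
Proof.
move=> q0.
pose S i J := \bigcap_(j in [set j | (J <= j)%N]) near_int (q j) i.+1%:R^-1.
pose T i := \bigcup_J S i J.
have mS i J : measurable (S i J).
  apply: bigcap_measurable => [|j _]; first by exists J => /=.
  exact: measurable_near_int.
have mT i : measurable (T i) by apply: bigcup_measurable => J _; exact: mS.
have muT i : (mu (T i) <= (4 * i.+1%:R^-1)%:E)%E.
  have ndS : nondecreasing_seq (S i).
    move=> J1 J2 J12; apply/subsetPset => x Sx j /= Jj.
    by apply: Sx => /=; exact: leq_trans Jj.
  have cvgS := nondecreasing_cvg_mu (mu := mu) (mS i) (mT i) ndS.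
  rewrite -(cvg_lim _ cvgS)//; apply: lime_le.
    by apply/cvg_ex; eexists; exact: cvgS.
  apply: nearW => J /=.
  apply: (@le_trans _ _ (mu (near_int (q J) i.+1%:R^-1))).
    apply: le_measure; rewrite ?inE; [exact: mS|exact: measurable_near_int|].
    by move=> x Sx; apply: Sx => /=.
  by apply: near_int_measure => //; rewrite invr_gt0.
exists (\bigcap_i T i); split.
- by apply: bigcap_measurable => // i _; exact: mT.
- apply/eqP; rewrite eq_le measure_ge0 andbT.
  apply/lee_addgt0Pr => e e0; rewrite add0e.
  pose i := Num.truncn (4 / e).
  apply: (@le_trans _ _ (mu (T i))).
    apply: le_measure; rewrite ?inE; [|exact: mT|by move=> x; exact].
    by apply: bigcap_measurable => // j _; exact: mT.
  apply: (le_trans (muT i)); rewrite lee_fin ler_pdivrMr// mulrC -ler_pdivrMr//.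
  exact/ltW/truncnS_gt.
- move=> x; apply: contra_notP => xT x01.
  have /existsNP[i xTi] : ~ forall i, T i x.
    by move=> h; apply: xT => i _; exact: h.
  exists i.+1%:R^-1; first by rewrite invr_gt0.
  move=> J; apply: contrapT => far; apply: xTi; exists J => // j /= Jj.
  apply: near_intP => // k r qx r2; rewrite ltNge; apply/negP => br.
  by apply: far; exists j, k, r.
Qed.

Lemma ae_unit_exists (P : R -> Prop) :
  {ae mu, forall x, 0 < x < 1 -> P x} -> exists2 x : R, 0 < x < 1 & P x.
Proof.
move=> [A [mA A0 PA]]; apply: contrapT => none.
have sub : `]0, 1[%classic `<=` A.
  move=> x; rewrite /= in_itv/= => x01; apply: PA => /= h.
  by apply: none; exists x => //; exact: h.
have : (mu `]0%R, 1%R[%classic <= mu A)%E.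
  by apply: le_measure => //; rewrite inE//; exact: measurable_itv.
rewrite A0 lebesgue_measure_itv/= lte_fin ltr01 sube0.
by rewrite lee_fin ler10.
Qed.

End almost_every.

(** * Exponent bounds from rational approximations *)

Section diophantine_upper_bound.
Variable R : realType.

(** Dirichlet's theorem with a bound near N^g gives [q] of at most that order, and the hypothesis
    forces it to be at least of order N^(1 - g); then q + N / q is of order at most N^g. *)
Lemma upper_Gamma_diophantine (a b g c : R) : 0 < g -> g < 1 -> 0 < b < 1 ->
    0 < c ->
    (forall (p : int) (q : nat), (0 < q)%N ->
      c * q%:R `^ (- (1 - g)^-1) <= `|a - p%:~R / q%:R|) ->
  (upper_Gamma a b <= g%:E)%E.
Proof.
move=> g0 g1 b01 c0 h.
have g10 : 0 < 1 - g by lra.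
(* The exponent in the lower bound [c * q^(- t)] for |q a - p|. *)
pose t := g / (1 - g); have t0 : 0 < t by rewrite divr_gt0.
have thE : (1 - g)^-1 = t + 1 by rewrite /t; field; rewrite gt_eqF.
pose c2 := c `^ t^-1; have c20 : 0 < c2 by rewrite powR_gt0.
apply: (@upper_Gamma_le R a b g (16 + 14 / c2)); first exact: ltW.
  by rewrite addr_gt0// divr_gt0.
move=> N N0; have NR0 : 0 < N%:R :> R by rewrite ltr0n.
have N1 : 1 <= N%:R :> R by rewrite ler1n.
have Ng0 : 0 < N%:R `^ g :> R by rewrite powR_gt0.
have Ng1 : 1 <= N%:R `^ g :> R by have := ler_powR N1 (ltW g0); rewrite powRr0.
pose Q := (Num.truncn (N%:R `^ g : R)).+1.
have QN : N%:R `^ g < Q%:R :> R by exact: truncnS_gt.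
have QN2 : Q%:R <= 2 * N%:R `^ g :> R.
  by rewrite -[leLHS]natr1; have /andP[+ _] := truncn_itv (ltW Ng0); lra.
have [p [q [/andP[q0 qQ] pq apq]]] := dirichlet a (ltn0Sn _ : (0 < Q)%N).
have q0' : 0 < q%:R :> R by rewrite ltr0n.
have qQ' : q%:R <= Q%:R :> R by rewrite ler_nat.
have Q0 : 0 < Q%:R :> R by rewrite ltr0n.
have apq' : `|q%:R * a - p%:~R| <= q%:R^-1.
  by apply: le_trans (ltW apq) _; rewrite lef_pV2 ?posrE.
have qlow : c2 * N%:R `^ (1 - g) <= q%:R.
  have := h p q q0.
  have -> : `|a - p%:~R / q%:R| = `|q%:R * a - p%:~R| / q%:R.
    have -> : q%:R * a - p%:~R = q%:R * (a - p%:~R / q%:R).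
      by field; rewrite gt_eqF.
    by rewrite normrM (gtr0_norm q0') mulrAC mulfV ?mul1r// gt_eqF.
  rewrite thE opprD powRD; last by apply/implyP => _; rewrite gt_eqF.
  rewrite powR_inv1 ?(ltW q0')// mulrA ler_pM2r ?invr_gt0// => cq.
  have {}cq : c * N%:R `^ g <= q%:R `^ t.
    have : c * q%:R `^ (- t) * N%:R `^ g <= 1.
      apply: (@le_trans _ _ (Q%:R^-1 * Q%:R)); last by rewrite mulVf// gt_eqF.
      apply: ler_pM; [|exact: ltW| |exact: ltW].
        by rewrite mulr_ge0 ?powR_ge0// ltW.
      by apply: le_trans cq (ltW apq).
    rewrite powRN mulrAC ler_pdivrMr ?powR_gt0// mul1r.
    by [].
  have ti0 : 0 <= t^-1 by rewrite invr_ge0 ltW.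
  have cN0 : c * N%:R `^ g \is Num.nneg by rewrite nnegrE mulr_ge0// ltW.
  have qt0 : q%:R `^ t \is @Num.nneg R by rewrite nnegrE powR_ge0.
  have := ge0_ler_powR ti0 cN0 qt0 cq.
  rewrite -powRrM mulfV ?gt_eqF// powRr1 ?(ltW q0')//.
  rewrite powRM ?(ltW c0) ?(ltW Ng0)// -powRrM.
  by have -> : g * t^-1 = 1 - g by rewrite /t; field; rewrite !gt_eqF.
apply: le_trans (diam_edit_rotation_le N q0 pq apq' b01) _.
have Nq : N%:R / q%:R <= N%:R `^ g / c2 :> R.
  rewrite ler_pdivrMr// mulrAC ler_pdivlMr//.
  apply: (@le_trans _ _ (N%:R `^ g * (c2 * N%:R `^ (1 - g)))).
    rewrite mulrCA -powRD; last by apply/implyP => _; rewrite gt_eqF.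
    by rewrite addrC subrK powRr1 ?(ltW NR0)// mulrC.
  by rewrite ler_pM2l.
have -> : (16 + 14 / c2) * N%:R `^ g = 16 * N%:R `^ g + 14 * (N%:R `^ g / c2).
  by ring.
by lra.
Qed.

Lemma irrational_away (a : R) (Q0 : nat) : irrational a ->
  exists2 c : R, 0 < c & forall (p : int) (q : nat), (0 < q < Q0)%N ->
    c <= `|a - p%:~R / q%:R|.
Proof.
move=> ia; elim: Q0 => [|Q0 [c c0 cP]]; first by exists 1 => // p q; lia.
have [->|Q00] := posnP Q0; first by exists 1 => // p q; lia.
have Q0' : 0 < Q0%:R :> R by rewrite ltr0n.
pose k := Num.floor (Q0%:R * a).
have /andP[k1 k2] := floor_bounds (Q0%:R * a); rewrite -/k in k1 k2.
have {}k1 : k%:~R < Q0%:R * a.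
  rewrite lt_neqAle k1 andbT; apply/eqP => kE; apply: ia.
  apply/rationalP; exists k, Q0; rewrite kE; field.
  by rewrite gt_eqF.
pose d := Num.min (Q0%:R * a - k%:~R) (k%:~R + 1 - Q0%:R * a).
have [dA dB] : d <= Q0%:R * a - k%:~R /\ d <= k%:~R + 1 - Q0%:R * a.
  by rewrite !ge_min !lexx orbT.
have d0 : 0 < d by rewrite lt_min; apply/andP; split; lra.
exists (Num.min c (d / Q0%:R)); first by rewrite lt_min c0 divr_gt0.
move=> p q /andP[q0]; rewrite ltnS leq_eqVlt => /orP[/eqP ->|qQ]; last first.
  by rewrite ge_min cP// q0.
rewrite ge_min; apply/orP; right; rewrite ler_pdivrMr//.
rewrite -{2}(gtr0_norm Q0') -normrM mulrBl divfK ?gt_eqF// mulrC.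
have [pk|kp] := lerP p k.
  have {}pk : p%:~R <= k%:~R :> R by rewrite ler_int.
  by rewrite ler_normr; apply/orP; left; lra.
have {}kp : k%:~R + 1 <= p%:~R :> R by rewrite -intrD1 ler_int lezD1.
by rewrite ler_normr; apply/orP; right; lra.
Qed.

(** If the approximations stopped at [Q0], irrationality would handle the finitely many smaller
    denominators and give a Diophantine constant. Fractions outside [0, 1] are no closer to [a] than
    0 or 1. *)
Lemma not_diophantine_approx (a kappa : R) : 0 < a < 1 -> irrational a ->
    0 <= kappa ->
    (forall c, 0 < c -> ~ forall (p : int) (q : nat), (0 < q)%N ->
      c * q%:R `^ (- kappa) <= `|a - p%:~R / q%:R|) ->
  forall Q0 : nat, exists q p : nat,
    [/\ (Q0 <= q)%N, (p <= q)%N & `|a - p%:R / q%:R| <= q%:R `^ (- kappa)].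
Proof.
move=> /andP[a0 a1] ia k0 h Q0; apply: contrapT => none.
have [c c0 cP] := irrational_away Q0.+1 ia.
apply: (h (Num.min c 1)); first by rewrite lt_min c0 ltr01.
move=> p q q0; have q0' : 0 < q%:R :> R by rewrite ltr0n.
have q1 : 1 <= q%:R :> R by rewrite ler1n.
have qk : q%:R `^ (- kappa) <= 1.
  have := ler_powR q1 (_ : - kappa <= 0); rewrite powRr0; apply.
  by rewrite oppr_le0.
have [qQ|Qq] := ltnP q Q0.+1.
  apply: le_trans (cP p q _); last by rewrite q0.
  apply: (@le_trans _ _ (c * 1)); last by rewrite mulr1.
  by apply: ler_pM; rewrite ?powR_ge0 ?le_min ?ler01 ?(ltW c0) ?ge_min ?lexx.
apply: (@le_trans _ _ (q%:R `^ (- kappa))).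
  by rewrite ler_piMl ?powR_ge0// ge_min lexx orbT.
have far (n : nat) : (n <= q)%N -> q%:R `^ (- kappa) <= `|a - n%:R / q%:R|.
  move=> nq; rewrite leNgt; apply/negP => near_n; apply: none.
  by exists q, n; split => //; [exact: ltnW|exact: ltW].
have [p0|p0] := lerP p 0.
  apply: le_trans (far 0%N _) _ => //; rewrite mul0r subr0 gtr0_norm//.
  rewrite ler_normr; apply/orP; left; rewrite lerBrDl gerDr.
  by rewrite pmulr_lle0 ?invr_gt0// lerz0.
have [pq|qp] := lerP p q%:Z.
  have [n pn] : exists n : nat, p = n%:Z by exists `|p|%N; rewrite gtz0_abs.
  by rewrite pn -pmulrn; apply: far; rewrite -lez_nat -pn.
apply: le_trans (far q _) _ => //; rewrite mulfV ?gt_eqF//.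
have qp1 : 1 <= p%:~R / q%:R :> R.
  by rewrite ler_pdivlMr// mul1r pmulrn ler_int ltW.
by rewrite ler0_norm ?ler_normr; [apply/orP; right; lra|lra].
Qed.

End diophantine_upper_bound.

Section good_approximations.
Variable R : realType.

(** The words have a length N <= 2 q / eps, at most 2 C eps^(-1 / g), and the diameter is at least
    b0 / (32 eps), hence a multiple of N^g. *)
Lemma upper_Gamma_approximable (a b g C b0 : R) : 0 < g -> g < 1 ->
    0 < b < 1 -> 0 < C -> 0 < b0 ->
    (forall B : R, exists p : int, exists q : nat, exists k : int, exists r : R,
      let eps := q%:R * a - p%:~R in
      [/\ (0 < q)%N /\ B <= q%:R, coprime `|p| q,
        0 < eps /\ 64 * (q%:R * eps) <= b0, q%:R <= C * eps `^ (1 - g^-1) &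
        [/\ q%:R * b = k%:~R + r, `|r| <= 1 / 2 & b0 <= `|r|]]) ->
  (g%:E <= upper_Gamma a b)%E.
Proof.
move=> g0 g1 /andP[bp b1] C0 b00 h.
apply: (@upper_Gamma_ge R a b g (b0 / 32 * (2 * C) `^ (- g))).
  by rewrite mulr_gt0 ?powR_gt0 ?divr_gt0 ?mulr_gt0.
move=> n.
have b1' : 0 < 1 - b by lra.
(* Besides [n <= N], this bound ensures 2 <= q b <= q - 2. *)
have [p [q [k [r]]]] := h (Num.max n%:R (Num.max (2 / b) (2 / (1 - b)))).
rewrite !ge_max => -[[q0 /andP[nq /andP[qb qb']]] pq [e0 qe] qC [qbE r2 br]].
have Q0 : 0 < q%:R :> R by rewrite ltr0n.
have Q1 : 1 <= q%:R :> R by rewrite ler1n.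
set e := q%:R * a - p%:~R in e0 qe qC.
have b01 : 0 < b < 1 by rewrite bp.
have qb2 : 2 <= q%:R * b by rewrite -ler_pdivrMr.
have qb2' : q%:R * b <= q%:R - 2.
  by move: qb'; rewrite ler_pdivrMr// mulrBr mulr1; lra.
have r0 : 0 < `|r| by apply: lt_le_trans br.
have [N [N1 N2 N3]] := diam_edit_rotation_ge q0 pq e0 b01 qb2 qb2' qbE r0 r2
  (le_trans qe br).
rewrite -/e in N1 N2 N3.
have e_le1 : e <= 1.
  have : e <= q%:R * e by rewrite ler_peMl// ltW.
  by lra.
exists N.
  rewrite -(ler_nat R); apply: le_trans nq _; apply: le_trans N1.
  by rewrite ler_pdivlMr// ler_piMr// ltW.
apply: le_trans N3.
have NC : N%:R <= 2 * C * e `^ (- g^-1).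
  apply: le_trans N2 _; rewrite -mulrA ler_pM2l// ler_pdivrMr//.
  apply: le_trans qC _; rewrite -mulrA ler_pM2l//.
  rewrite -{3}(powRr1 (ltW e0)) -powRD; last first.
    by apply/implyP => _; rewrite gt_eqF.
  by rewrite addrC.
have NG : N%:R `^ g <= (2 * C) `^ g / e.
  have C2 : 0 < 2 * C by rewrite mulr_gt0.
  have := @ge0_ler_powR R g (ltW g0) N%:R (2 * C * e `^ (- g^-1)).
  rewrite !nnegrE ler0n mulr_ge0 ?powR_ge0 ?(ltW C2)// => /(_ isT isT NC).
  rewrite powRM ?powR_ge0 ?(ltW C2)// -powRrM mulNr mulVf ?gt_eqF//.
  by rewrite powR_inv1// ltW.
apply: (@le_trans _ _ (b0 / 32 * (2 * C) `^ (- g) * ((2 * C) `^ g / e))).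
  by rewrite ler_pM2l// mulr_gt0 ?powR_gt0 ?divr_gt0 ?mulr_gt0.
have -> : b0 / 32 * (2 * C) `^ (- g) * ((2 * C) `^ g / e) = b0 / (32 * e).
  have C2 : 0 < (2 * C) `^ g by rewrite powR_gt0// mulr_gt0.
  rewrite powRN; field; rewrite !gt_eqF//.
by rewrite ler_pM2r// invr_gt0 mulr_gt0.
Qed.

End good_approximations.

(** * The approximation function *)

Section damped_power.
Variables (R : realType) (c theta : R).
Hypotheses (c0 : 0 < c) (theta2 : 2 <= theta).

(* The logarithm makes [t ^+ 2 * phi t] tend to [0] even when [theta = 2],
   that is, when [g = 1 / 2]. *)
Definition damped_power (t : R) := c * t `^ (- theta) / (1 + ln t).
Local Notation phi := damped_power.

Let ln1D (t : R) : 1 <= t -> 1 <= 1 + ln t.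
Proof. by move=> t1; rewrite lerDl ln_ge0. Qed.

Let ln1D_gt0 (t : R) : 1 <= t -> 0 < 1 + ln t.
Proof. by move=> /ln1D; apply: lt_le_trans. Qed.

Let ge1_gt0 (t : R) : 1 <= t -> 0 < t.
Proof. exact: lt_le_trans. Qed.

Lemma damped_power_gt0 (t : R) : 1 <= t -> 0 < phi t.
Proof.
by move=> t1; rewrite divr_gt0 ?ln1D_gt0// mulr_gt0// powR_gt0// ge1_gt0.
Qed.

Lemma damped_power_le (t : R) : 1 <= t -> phi t <= c * t `^ (- theta).
Proof.
move=> t1; rewrite ler_pdivrMr ?ln1D_gt0// ler_peMr ?ln1D//.
by rewrite mulr_ge0 ?powR_ge0// ltW.
Qed.

Let powR_le2 (t : R) : 1 <= t -> t `^ (- theta) <= (t ^+ 2)^-1.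
Proof.
move=> t1; rewrite -powR_invn ?(ltW (ge1_gt0 t1))//; apply: ler_powR => //.
by rewrite lerN2.
Qed.

Lemma damped_power_le_sqr (t : R) : 1 <= t -> phi t <= c / t ^+ 2.
Proof.
move=> t1; apply: le_trans (damped_power_le t1) _.
by rewrite ler_pM2l// powR_le2.
Qed.

Let damped_mono (r t u : R) : 0 <= r -> 1 <= t -> t <= u ->
  c * u `^ (- r) / (1 + ln u) <= c * t `^ (- r) / (1 + ln t).
Proof.
move=> r0 t1 tu; have u1 := le_trans t1 tu.
have t0 := ge1_gt0 t1; have u0 := ge1_gt0 u1.
apply: ler_pM; rewrite ?invr_ge0 ?mulr_ge0 ?powR_ge0 ?(ltW c0)//.
- exact: ltW (ln1D_gt0 u1).
- rewrite ler_pM2l// !powRN lef_pV2 ?posrE ?powR_gt0//.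
  by apply: ge0_ler_powR; rewrite ?nnegrE ?(ltW t0) ?(ltW u0).
- by rewrite lef_pV2 ?posrE ?ln1D_gt0// lerD2l ler_ln.
Qed.

Lemma damped_power_noninc (t u : R) : 1 <= t -> t <= u -> phi u <= phi t.
Proof. by move: theta2 => ht; apply: damped_mono; lra. Qed.

Lemma damped_power_mul_noninc (t u : R) :
  1 <= t -> t <= u -> u * phi u <= t * phi t.
Proof.
have E (v : R) : 1 <= v -> v * phi v = c * v `^ (- (theta - 1)) / (1 + ln v).
  move=> v1; rewrite opprB powRD; last first.
    by apply/implyP => _; rewrite gt_eqF// ge1_gt0.
  by rewrite powRr1 ?(ltW (ge1_gt0 v1))// /phi; ring.
move=> t1 tu; rewrite !E//; last exact: le_trans tu.
by move: theta2 => ht; apply: damped_mono; lra.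
Qed.

Lemma damped_power_sqr_small (e : R) : 0 < e -> exists T : R,
  forall t : R, 1 <= t -> T <= t -> t ^+ 2 * phi t <= e.
Proof.
move=> e0; exists (expR (c / e)) => t t1 Tt.
have t0 := ge1_gt0 t1; have l0 := ln1D_gt0 t1.
have lt : c / e <= 1 + ln t.
  have e1 : 1 <= expR 1 :> R by have := @expR_ge1Dx R 1; lra.
  rewrite -ler_expR expRD lnK ?posrE//; apply: (le_trans Tt).
  by rewrite ler_peMl ?(ltW t0).
apply: (@le_trans _ _ (c / (1 + ln t))).
  rewrite /phi mulrA ler_pM2r ?invr_gt0// mulrCA ler_piMr ?(ltW c0)//.
  rewrite -(mulfV (lt0r_neq0 (exprn_gt0 2 t0))) ler_pM2l ?exprn_gt0//.
  exact: powR_le2.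
by rewrite ler_pdivrMr// mulrC -ler_pdivrMr.
Qed.

(** The logarithm is absorbed by the power of exponent [kappa - theta]. *)
Lemma damped_power_ge (kappa : R) : theta < kappa ->
  exists2 d : R, 0 < d & forall t : R, 1 <= t -> d * t `^ (- kappa) <= phi t.
Proof.
move=> tk; pose e := kappa - theta; have e0 : 0 < e by rewrite subr_gt0.
exists (c / (1 + e^-1)).
  by rewrite divr_gt0// addr_gt0 ?invr_gt0.
move=> t t1; have t0 := ge1_gt0 t1.
have lt : 1 + ln t <= (1 + e^-1) * t `^ e.
  rewrite mulrDl mul1r; apply: lerD.
    by have := ler_powR t1 (ltW e0); rewrite powRr0.
  have te0 : 0 < t `^ e by rewrite powR_gt0.
  have := ltW (ln_sublinear te0); rewrite ln_powR => h.
  by rewrite mulrC ler_pdivlMr// mulrC.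
have -> : - kappa = - theta - e by rewrite /e; ring.
rewrite powRB; last by apply/implyP => _; rewrite gt_eqF.
rewrite /phi ler_pdivlMr ?ln1D_gt0//.
have te0 : 0 < t `^ e by rewrite powR_gt0.
have ei0 : 0 < 1 + e^-1 by rewrite addr_gt0 ?invr_gt0.
have -> : c / (1 + e^-1) * (t `^ (- theta) / t `^ e) * (1 + ln t) =
  c * t `^ (- theta) * ((1 + ln t) / ((1 + e^-1) * t `^ e)).
  by rewrite invfM; ring.
rewrite ler_piMr ?mulr_ge0 ?powR_ge0 ?(ltW c0)//.
by rewrite ler_pdivrMr ?mul1r// mulr_gt0.
Qed.

End damped_power.

(** * Numbers with a given exponent *)

Section exact_exponent.
Variable R : realType.

Lemma large_branching (u : R) : 0 <= u < 1 ->
  exists2 m : nat, (1 < m)%N & 2 * (8 * m%:R) `^ u <= m%:R :> R.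
Proof.
move=> /andP[u0 u1]; pose v := 1 - u; have v0 : 0 < v by rewrite subr_gt0.
pose z : R := 2 * 8 `^ u; have z0 : 0 < z by rewrite mulr_gt0// powR_gt0.
exists (Num.truncn (z `^ v^-1)).+2 => //.
set m : R := (Num.truncn (z `^ v^-1)).+2%:R.
have m0 : 0 < m by rewrite ltr0n.
have zm : z `^ v^-1 <= m.
  by apply: (le_trans (ltW (truncnS_gt _))); rewrite ler_nat.
have : z <= m `^ v.
  have -> : z = (z `^ v^-1) `^ v.
    by rewrite -powRrM mulVf ?gt_eqF// powRr1// ltW.
  by apply: ge0_ler_powR; rewrite ?nnegrE ?powR_ge0// ltW.
rewrite -(ler_pM2r (powR_gt0 u m0)) -powRD; last first.
  by apply/implyP => _; rewrite gt_eqF.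
rewrite /v subrK powRr1 ?(ltW m0)//; apply: le_trans.
by rewrite powRM ?(ltW m0)// mulrA.
Qed.

(** As [2 * u] exceeds [s * theta], the spare power absorbs the logarithm; [s = 0] is treated apart
    because of a division by [s]. *)
Lemma damped_power_mass (c theta s u : R) : 0 < c -> 2 <= theta -> 0 <= s ->
    0 <= u -> s * theta / 2 < u ->
  exists2 c1 : R, 0 < c1 & forall t : R, 1 <= t ->
    c1 * (t ^+ 2) `^ (- u) <= damped_power c theta t `^ s.
Proof.
move=> c0 th2 s0 u0 su.
have t2u (t : R) : 1 <= t -> (t ^+ 2) `^ (- u) = t `^ (- (2 * u)).
  move=> t1; rewrite -powR_mulrn ?(le_trans ler01)// -powRrM.
  by rewrite mulrN.
move: s0; rewrite le_eqVlt => /orP[/eqP <-|s0].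
  exists 1 => // t t1; rewrite mul1r powRr0 t2u//.
  have := ler_powR t1 (_ : - (2 * u) <= 0); rewrite powRr0; apply.
  by rewrite oppr_le0 mulr_ge0.
have [d d0 dP] : exists2 d : R, 0 < d & forall t : R, 1 <= t ->
    d * t `^ (- (2 * u / s)) <= damped_power c theta t.
  apply: damped_power_ge => //; rewrite ltr_pdivlMr//.
  by lra.
exists (d `^ s) => [|t t1]; first exact: powR_gt0.
have := @ge0_ler_powR R s (ltW s0) _ _ _ _ (dP t t1).
rewrite !nnegrE mulr_ge0 ?powR_ge0 ?(ltW d0)//.
rewrite ltW ?damped_power_gt0// => /(_ isT isT).
rewrite powRM ?powR_ge0 ?(ltW d0)// -powRrM t2u//.
by rewrite mulNr divfK// gt_eqF.
Qed.

(** The upper bound holds for every [b]: raising [g] slightly absorbs the logarithm in [far]. The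
    lower bound uses those fractions of [approx] whose denominators suit [b]. *)
Lemma exponent_of_approximations (a g c : R) : 1 / 2 <= g -> g < 1 -> 0 < c ->
    (forall (p : int) (q : nat), (0 < q)%N ->
      damped_power c (1 - g)^-1 q%:R <= `|a - p%:~R / q%:R|) ->
    (forall B : R, exists p : int, exists q : nat, exists H : R,
      let f := p%:~R / q%:R in
      [/\ (0 < q)%N, coprime `|p| q, 1 <= H /\ B <= H,
        H < q%:R <= H / (4 * c) &
        f + damped_power c (1 - g)^-1 H <= a <=
          f + 2 * damped_power c (1 - g)^-1 H]) ->
  {ae (@lebesgue_measure R), forall b : R, 0 < b < 1 -> upper_Gamma a b = g%:E}.
Proof.
move=> g2 g1 c0 far approx; set theta := (1 - g)^-1 in far approx.
have g0 : 0 < g by lra.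
have g10 : 0 < 1 - g by lra.
have th2 : 2 <= theta.
  by rewrite /theta -[leRHS]mul1r ler_pdivlMr//; lra.
have upper b : 0 < b < 1 -> (upper_Gamma a b <= g%:E)%E.
  move=> b01; apply/lee_addgt0Pr => e e0; rewrite -EFinD.
  pose g' := Num.min (g + e) ((1 + g) / 2).
  have gg' : g < g' by rewrite lt_min; apply/andP; split; lra.
  have g'1 : g' < 1 by rewrite gt_min; apply/orP; right; lra.
  have thk : theta < (1 - g')^-1 by rewrite ltf_pV2 ?posrE ?subr_gt0//; lra.
  have [d d0 dP] := damped_power_ge c0 thk.
  apply: (@le_trans _ _ g'%:E); last by rewrite lee_fin ge_min lexx.
  apply: (@upper_Gamma_diophantine R a b g' d) => //; first by lra.
  move=> p q q0; apply: le_trans (far p q q0); apply: dP.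
  by rewrite ler1n.
(* The fractions are chosen before [b], so that the exceptional null set does not depend on [b]. *)
have [pf hpf] := boolp.choice (fun j : nat => approx j%:R).
have [qf hqf] := boolp.choice hpf.
have [Hf hHf] := boolp.choice hqf.
have qf0 j : (0 < qf j)%N by have [] := hHf j.
have [A [mA A0 PA]] := ae_far_from_int R qf0.
exists A; split => //; apply: subset_trans PA; apply: subsetC => b ae_b b01.
apply/eqP; rewrite eq_le upper//=; have [b0 b00 bP] := ae_b b01.
have C0 : 0 < (4 * c)^-1 by rewrite invr_gt0 mulr_gt0.
apply: (@upper_Gamma_approximable R a b g (4 * c)^-1 b0) => // B.
(* With [q * (4 * c) <= H] and [eps <= q * (2 * rho)], this bound on H^2 rho gives 64 q eps <=
   b0. *)
have e0 : 0 < 8 * c ^+ 2 * (b0 / 64).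
  by rewrite mulr_gt0 ?divr_gt0// mulr_gt0// exprn_gt0.
have [T TP] := damped_power_sqr_small c0 th2 e0.
have [j [k [r [Jj qbE r2 br]]]] := bP (Num.truncn (Num.max B T)).+1.
have [q0 pq [H1 jH] /andP[Hq qH] /andP[fa af]] := hHf j.
exists (pf j), (qf j), k, r.
move: q0 pq H1 jH Hq qH fa af qbE; set p := pf j; set q := qf j; set H := Hf j.
move=> q0 pq H1 jH Hq qH fa af qbE.
have : Num.max B T <= H.
  apply: le_trans (le_trans (ltW (truncnS_gt _)) _) jH.
  by rewrite ler_nat.
rewrite ge_max => /andP[BH TH].
have Q0 : 0 < q%:R :> R by rewrite ltr0n.
have H0 : 0 < H by apply: lt_le_trans H1.
have r0 := damped_power_gt0 theta c0 H1.
set rho := damped_power c theta H in r0 fa af.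
set eps := q%:R * a - p%:~R.
have epsE : eps = q%:R * (a - p%:~R / q%:R).
  by rewrite /eps; field; rewrite gt_eqF.
have eps_ge : q%:R * rho <= eps by rewrite epsE ler_pM2l//; lra.
have eps_le : eps <= q%:R * (2 * rho) by rewrite epsE ler_pM2l//; lra.
have eps0 : 0 < eps by apply: lt_le_trans eps_ge; rewrite mulr_gt0.
have qcH : q%:R * (4 * c) <= H by rewrite -ler_pdivlMr// mulr_gt0.
split=> //.
- by split => //; apply: le_trans BH (ltW Hq).
- split=> //.
  have h1 := TP H H1 TH; rewrite -/rho in h1.
  have h2 : (q%:R * (4 * c)) ^+ 2 <= H ^+ 2.
    by apply: lerXn2r; rewrite ?nnegrE ?mulr_ge0 ?(ltW H0)// ltW.
  have h3 : (q%:R * (4 * c)) ^+ 2 * rho <= 8 * c ^+ 2 * (b0 / 64).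
    by apply: le_trans h1; rewrite ler_pM2r.
  have h4 : q%:R * eps <= q%:R * (q%:R * (2 * rho)) by rewrite ler_pM2l.
  have c2 : 0 < 8 * c ^+ 2 by rewrite mulr_gt0// exprn_gt0.
  have h5 : 8 * c ^+ 2 * (q%:R * (q%:R * (2 * rho))) <= 8 * c ^+ 2 * (b0 / 64).
    by apply: le_trans h3; rewrite le_eqVlt; apply/orP; left; apply/eqP; ring.
  by move: h5; rewrite ler_pM2l//; lra.
- have heps : eps <= H `^ (1 - theta).
    have := damped_power_le theta c0 H1; rewrite -/rho => h1.
    apply: (le_trans eps_le).
    rewrite powRD; last by apply/implyP => _; rewrite gt_eqF.
    rewrite powRr1 ?(ltW H0)//.
    have Ht : 0 < H `^ (- theta) by rewrite powR_gt0.
    apply: (@le_trans _ _ (q%:R * (2 * (c * H `^ (- theta))))).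
      by rewrite ler_pM2l// ler_pM2l.
    have -> : q%:R * (2 * (c * H `^ (- theta))) =
      q%:R * (4 * c) * H `^ (- theta) / 2 by field.
    have : q%:R * (4 * c) * H `^ (- theta) <= H * H `^ (- theta).
      by rewrite ler_pM2r.
    have : 0 < H * H `^ (- theta) by rewrite mulr_gt0.
    by lra.
  apply: (le_trans qH); rewrite mulrC ler_pM2l//.
  (* This exponent is the inverse of [1 - theta], so eps <= H^(1 - theta) becomes H <= eps^(1 - 1 /
     g). *)
  have -> : 1 - g^-1 = - ((1 - g) / g) by field; rewrite gt_eqF.
  have w0 : 0 < (1 - g) / g by rewrite divr_gt0.
  have HE : H = (H `^ (1 - theta)) `^ (- ((1 - g) / g)).
    rewrite -powRrM -{1}(powRr1 (ltW H0)); congr (_ `^ _).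
    by rewrite /theta; field; rewrite !gt_eqF.
  rewrite {1}HE !powRN lef_pV2 ?posrE ?powR_gt0//.
  by apply: ge0_ler_powR; rewrite ?nnegrE ?powR_ge0// ltW.
Qed.

Lemma exact_exponent_family (g s : R) : 1 / 2 <= g -> 0 <= s < 2 - 2 * g ->
  exists G : R -> R, exists C : R, [/\ 0 < C,
    forall x : R, 0 <= x < 1 -> [/\ 0 < G x < 1, irrational (G x) &
      {ae (@lebesgue_measure R),
        forall b : R, 0 < b < 1 -> upper_Gamma (G x) b = g%:E}] &
    forall x y : R, 0 <= x < 1 -> 0 <= y < 1 ->
      `|x - y| <= C * `|G x - G y| `^ s].
Proof.
move=> g2 /andP[s0 sg].
have g1 : g < 1 by lra.
have g10 : 0 < 1 - g by lra.
pose theta := (1 - g)^-1.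
have th0 : 0 < theta by rewrite invr_gt0.
have th2 : 2 <= theta.
  by rewrite /theta -[leRHS]mul1r ler_pdivlMr//; lra.
have sth : s * theta < 2 by rewrite ltr_pdivrMr//; lra.
have sth0 : s <= s * theta / 2.
  by have := ler_wpM2l s0 th2; lra.
(* The midpoint of the range left by [damped_power_mass] and [large_branching], nonempty since s < 2
   - 2 g. *)
pose u := (s * theta / 2 + 1) / 2.
have u0 : 0 <= u by rewrite /u; lra.
have su : s * theta / 2 < u by rewrite /u; lra.
have u1 : u < 1 by rewrite /u; lra.
have [m m1 mu] : exists2 m : nat, (1 < m)%N & 2 * (8 * m%:R) `^ u <= m%:R :> R.
  by apply: large_branching; rewrite u0.
have m0 : (0 < m)%N by exact: ltnW.
have M1 : 1 <= m%:R :> R by rewrite ler1n.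
have ms : (8 * m%:R) `^ s <= m%:R :> R.
  apply: le_trans mu; apply: (@le_trans _ _ ((8 * m%:R) `^ u)).
    by apply: ler_powR; lra.
  by rewrite ler_peMl ?powR_ge0// ler1n.
have M16 : 0 < 16 * m%:R :> R by lra.
have [K KM] : exists K : R, K * (16 * m%:R) = 1.
  by exists (16 * m%:R)^-1; rewrite mulVf// gt_eqF.
have K0 : 0 < K by rewrite -(pmulr_lgt0 _ M16) KM.
have [c KE] : exists c : R, K = 512 * c by exists (K / 512); lra.
have c0 : 0 < c by lra.
have [c1 c10 c1P] := damped_power_mass c0 th2 s0 u0 su.
have [G [C [C0 G01 Gfar Gnear Ghol]]] := tree_family m0 KM KE
  (damped_power_le_sqr c0 th2) (damped_power_gt0 theta c0)
  (damped_power_noninc c0 th2) (damped_power_mul_noninc c0 th2)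
  s0 c10 c1P (damped_power_sqr_small c0 th2) mu ms m1.
exists G, C; split=> // x x01; have := G01 x x01 => Gx.
split; first by lra.
- move=> /rationalP[p [[|q] Gq]].
    (* A denominator 0 would give the value 0, outside [1/4, 3/8]. *)
    by move: Gx; rewrite Gq invr0 mulr0; lra.
  have := Gfar x x01 p q.+1 isT; rewrite Gq subrr normr0 leNgt.
  by rewrite damped_power_gt0// ler1n.
- exact: exponent_of_approximations (Gfar x x01) (Gnear x x01).
Qed.

End exact_exponent.

(** * The dimension formula *)

Theorem corollary2 (R : realType) (g : R) (hg : 1 / 2 <= g <= 1) :
  hausdorff_dim
    [set a : R | [/\ 0 < a < 1, irrational a &
      {ae lebesgue_measure, forall b : R,
        0 < b < 1 -> upper_Gamma a b = g%:E}]]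
  = (2 - 2 * g)%:E.
Proof.
move: hg => /andP[g2 g1]; apply/eqP; rewrite eq_le; apply/andP; split.
- apply: hausdorff_dim_le => [|s sg]; first lra.
  (* Any g' strictly between [w] and [g] makes (1 - g')^-1 at least 1 and its product with [s]
     larger than 2. *)
  pose w := Num.max 0 (1 - s / 2).
  have wg : w < g by rewrite gt_max; apply/andP; split; lra.
  have w0 : 0 <= w by rewrite le_max lexx.
  have ws : 1 - s / 2 <= w by rewrite le_max lexx orbT.
  pose g' := (w + g) / 2.
  have g'1 : 0 < 1 - g' by rewrite /g'; lra.
  have s0 : 0 < s by lra.
  apply: (@hausdorff_measure_limsup _ s (1 - g')^-1) => //.
  + by rewrite -[leRHS]mul1r ler_pdivlMr// /g'; lra.
  + by rewrite mulrC ltr_pdivlMr// /g'; lra.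
  + move=> a [a01 ia aG]; apply: not_diophantine_approx => //.
      by rewrite invr_ge0 ltW.
    (* If [a] were Diophantine with this exponent, every [b] would give an exponent of at most g' <
       g. *)
    move=> c c0 far; have [b b01 bG] := ae_unit_exists aG.
    have g'0 : 0 < g' by rewrite /g'; lra.
    have := upper_Gamma_diophantine g'0 _ b01 c0 far.
    by rewrite bG lee_fin leNgt => /(_ _)/negP; apply; rewrite /g'; lra.
(* For g = 1 the range of [s] is empty, and the bound is 0. *)
- apply: hausdorff_dim_ge => s sg.
  have [G [C [C0 GE GC]]] := exact_exponent_family g2 sg.
  by apply: (hausdorff_measure_holder _ C0 GE GC); case/andP: sg.
Qed.
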